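(* Consider the following randomized process (Algorithm 1) for a repulsive pair potential $\phi$ of range at most $r>0$, activity $\lambda>0$, update radius $\ell\in\mathbb{N}$ and a Bayes filter correction $\kappa$ on $\Lambda=[0,L)^d$. Set $t=0$, $S_0=V$, $X_0=\emptyset$. While $S_t\ne\emptyset$: draw $v_t\in S_t$ uniformly at random; set $B=B(S_t,v_t,\ell)$; draw $F_t\sim\mathrm{Ber}\Big(\kappa(S_t,v_t,X_t)\cdot\frac{Z_{\lambda_{X_t\cap\Lambda_{\partial B}}}(\Lambda_B)}{Z_{\lambda_{X_t\cap\Lambda_{\partial B\cup\{v_t\}}}}(\Lambda_{B\setminus\{v_t\}})}\Big)$; if $F_t=1$, draw $Y$ from $\mu^{\Lambda_B}_{\lambda_{X_t\cap(\Lambda\setminus\Lambda_B)}\mathbf 1_{\Lambda_B}}$ and set $X_{t+1}=(X_t\setminus\Lambda_B)\cup Y$ and $S_{t+1}=S_t\setminus\{v_t\}$; if $F_t=0$, set $X_{t+1}=X_t$ and $S_{t+1}=S_t\cup\partial B$; increase $t$ by one. Once $S_t=\emptyset$ all variables stay constant. Then for all $t\in\mathbb{N}_0$ with $\Pr(S_t=\emptyset)>0$ and all measurable events $A$ of finite point sets in $\Lambda$, $\Pr(X_t\in A\mid S_t=\emptyset)=\mu_\lambda(A)$.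
   Context: Let $\phi$ be symmetric measurable, $\phi\ge0$, with $\phi(x,y)=0$ whenever $\|x-y\|>r$. For bounded measurable $\Lambda'$ and activity function $f$, $Z_f(\Lambda')=\sum_{k\ge0}\frac1{k!}\int_{\Lambda'^k}\prod_i f(x_i)e^{-\sum_{i<j}\phi(x_i,x_j)}dx$ and $\mu_f$ is the corresponding Gibbs measure on finite point sets (with the $\sigma$-field generated by counting maps); $\mu_f^{\Lambda'}$ is the image of $\mu_f$ under $\eta\mapsto\eta\cap\Lambda'$; $\mathbf 1_{\Lambda'}$ denotes restricting the activity to $\Lambda'$ (multiplying by the indicator). For a point set $\eta$, $\lambda_\eta(y)=\lambda e^{-\sum_{x\in\eta}\phi(x,y)}$. A configuration $\eta$ is feasible if $\phi(x,y)<\infty$ for all distinct $x,y\in\eta$. Boxes: $N=\lceil L/r\rceil$, $V=\{0,\dots,N-1\}^d$, $\Lambda_v=\prod_{i=1}^d[v_ir,(v_i+1)r)\cap\Lambda$, $\Lambda_S=\bigcup_{v\in S}\Lambda_v$; $B_v(k)=\{w\in V:\|v-w\|_\infty\le k\}$; $\partial S=(\bigcup_{v\in S}B_v(1))\setminus S$; $B(S,v,\ell)=\{v\}\cup(B_v(\ell)\setminus S)$. A Bayes filter correction is a function $\kappa:2^V\times V\times\mathcal N_\Lambda\to[0,1]$ such that for every nonempty $S\subseteq V$ and $v\in S$: (1) $\kappa(S,v,\cdot)$ is measurable with respect to the $\sigma$-field on $\mathcal N_{\Lambda_S}$, i.e. $\kappa(S,v,\eta)=\kappa(S,v,\eta\cap\Lambda_S)$;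 (2) there is $\varepsilon>0$ such that, with $B=B(S,v,\ell)$ and $H=V\setminus(S\cup B)$, for all feasible $\eta$: $\varepsilon\le\kappa(S,v,\eta)\le\inf\Big\{\frac{Z_{\lambda_{\xi\cup(\eta\cap\Lambda_S)}}(\Lambda_{B\setminus\{v\}})}{Z_{\lambda_{\xi\cup(\eta\cap\Lambda_{S\setminus\{v\}})}}(\Lambda_B)}\Big\}$, the infimum over finite $\xi\subset\Lambda_H$ with $\xi\cup(\eta\cap\Lambda_S)$ feasible. $\mu_\lambda$ is the Gibbs measure on $\Lambda$ with constant activity $\lambda$. *)

(* Defs.v *)
From HB Require Import structures.
From mathcomp Require Import all_boot all_order all_algebra finmap.
From mathcomp Require Import all_classical all_reals all_analysis.
From mathcomp Require Import measurable_realfun.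

Set Implicit Arguments.
Unset Strict Implicit.
Unset Printing Implicit Defensive.
Import Order.TTheory GRing.Theory Num.Theory.
Local Open Scope classical_set_scope.
Local Open Scope ring_scope.

Section tuple_measure.
Context {R : realType} {disp : measure_display} {T : measurableType disp}.
Variable mu : {sigma_finite_measure set T -> \bar R}.

Section cons.
Variables (n : nat) (m : {sigma_finite_measure set (n.-tuple T) -> \bar R}).

Definition pair_cons (p : T * n.-tuple T) : n.+1.-tuple T :=
  [the n.+1.-tuple T of p.1 :: p.2].

Lemma measurable_pair_cons : measurable_fun [set: T * n.-tuple T] pair_cons.
Proof. exact: measurable_cons. Qed.

Definition cons_measure0 : set (n.+1.-tuple T) -> \bar R :=
  pushforward (mu \x m)%E pair_cons.

Let cons_measure0_0 : cons_measure0 set0 = 0%E.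
Proof. by rewrite /cons_measure0 /pushforward preimage_set0 measure0. Qed.

Let cons_measure0_ge0 A : (0 <= cons_measure0 A)%E.
Proof. by rewrite /cons_measure0 /pushforward; exact: measure_ge0. Qed.

Let cons_measure0_sigma_additive : semi_sigma_additive cons_measure0.
Proof.
have mf := measurable_pair_cons.
move=> F mF tF mUF; rewrite /cons_measure0 /pushforward preimage_bigcup.
apply: measure_semi_sigma_additive.
- by move=> k; rewrite -[X in measurable X]setTI; exact: mf.
- apply/trivIsetP => /= i j _ _ ij; rewrite -preimage_setI.
  by move/trivIsetP : tF => /(_ _ _ _ _ ij) ->//; rewrite preimage_set0.
- by rewrite -preimage_bigcup -[X in measurable X]setTI; exact: mf.
Qed.

HB.instance Definition _ := isMeasure.Build _ _ _ cons_measure0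
  cons_measure0_0 cons_measure0_ge0 cons_measure0_sigma_additive.

Let cons_measure0_sigma_finite : sigma_finite [set: n.+1.-tuple T] cons_measure0.
Proof.
have /sigma_finiteP[F [TF ndF Foo]] := sigma_finiteT mu.
have /sigma_finiteP[G [TG ndG Goo]] := sigma_finiteT m.
pose split (t : n.+1.-tuple T) : T * n.-tuple T :=
  (tnth t ord0, [tuple of behead t]).
have ms : measurable_fun setT split.
  apply: measurable_fun_pair; first exact: measurable_tnth.
  exact: measurable_behead.
have consK : cancel pair_cons split.
  by move=> [x y]; congr pair; exact/val_inj.
exists (fun k => split @^-1` (F k `*` G k)).
  apply/esym; rewrite -subTset => t _.
  have [i _ Fi] : (\bigcup_i F i) (split t).1 by rewrite -TF.
  have [j _ Gj] : (\bigcup_i G i) (split t).2 by rewrite -TG.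
  exists (maxn i j) => //; split.
    by move: Fi; exact/subsetPset/ndF/leq_maxl.
  by move: Gj; exact/subsetPset/ndG/leq_maxr.
move=> k; have [mF Fk] := Foo k; have [mG Gk] := Goo k; split.
  by rewrite -[X in measurable X]setTI; apply: ms => //; exact: measurableX.
rewrite /cons_measure0 /pushforward -comp_preimage.
rewrite (_ : split \o pair_cons = id); last first.
  by apply/funext => p /=; rewrite consK.
by rewrite preimage_id product_measure1E// lte_mul_pinfty// ge0_fin_numE.
Qed.

HB.instance Definition _ := Measure_isSigmaFinite.Build _ _ _ cons_measure0
  cons_measure0_sigma_finite.

Definition cons_measure : {sigma_finite_measure set (n.+1.-tuple T) -> \bar R} :=
  cons_measure0.

End cons.

(* the n-fold product measure mu \x ... \x mu on n.-tuple T *)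
Fixpoint tuple_measure n : {sigma_finite_measure set (n.-tuple T) -> \bar R} :=
  match n with
  | 0 => \d_([tuple of [::]] : 0.-tuple T)
  | k.+1 => cons_measure (tuple_measure k)
  end.

End tuple_measure.

Section points.
Context (R : realType) (d : nat).

Definition rpoint := d.-tuple (measurableTypeR R).

Definition lebesgue_point : {sigma_finite_measure set rpoint -> \bar R} :=
  tuple_measure (@lebesgue_measure R) d.

(* Euclidean distance *)
Definition eucl_dist (x y : rpoint) : R :=
  Num.sqrt (\sum_(i < d) ((tnth x i : R) - (tnth y i : R)) ^+ 2).

Definition restr (A : set rpoint) (eta : {fset rpoint}) : {fset rpoint} :=
  [fset x in eta | x \in A]%fset.

Definition counting_events : set (set {fset rpoint}) :=
  [set E | exists2 B : set rpoint, measurable B &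
           exists k : nat, E = [set eta | #|` restr B eta| = k]].

(* finite point sets, with the sigma-field generated by the counting maps *)
Definition config := g_sigma_algebraType counting_events.

Definition configs_in (A : set rpoint) : set config :=
  [set eta | forall x, x \in (eta : {fset rpoint}) -> A x].

End points.

Section gibbs.
Context {R : realType} {d : nat}.
Variable phi : rpoint R d -> rpoint R d -> \bar R.
Local Open Scope ereal_scope.

(* potentials and activities take values in [0, +oo]; expeR (- +oo) = 0 *)
Definition feasible (eta : {fset rpoint R d}) : Prop :=
  forall x y, x \in eta -> y \in eta -> x != y -> phi x y < +oo.

Definition energy k (x : k.-tuple (rpoint R d)) : \bar R :=
  \sum_(i < k) \sum_(j < k | (i < j)%N) phi (tnth x i) (tnth x j).

Definition weight (f : rpoint R d -> \bar R) k (x : k.-tuple (rpoint R d)) :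
    \bar R :=
  (\prod_(i < k) f (tnth x i)) * expeR (- energy x).

Definition tuples_in (A : set (rpoint R d)) k : set (k.-tuple (rpoint R d)) :=
  [set x | forall i, A (tnth x i)].

Definition partition_fun (f : rpoint R d -> \bar R) (A : set (rpoint R d)) :
    \bar R :=
  \sum_(0 <= k <oo) ((k`!%:R : R)^-1)%:E *
    \int[tuple_measure (lebesgue_point R d) k]_(x in @tuples_in A k) weight f x.

Definition config_of k (x : k.-tuple (rpoint R d)) : config R d :=
  [fset z in tval x]%fset.

(* mu_f on Lam as a set function: an ordered k-tuple x has density
   1 / k! * prod_i f x_i * exp (- sum_(i < j) phi x_i x_j) / Z_f(Lam) *)
Definition gibbs (f : rpoint R d -> \bar R) (Lam : set (rpoint R d))
    (E : set (config R d)) : \bar R :=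
  (\sum_(0 <= k <oo) ((k`!%:R : R)^-1)%:E *
     \int[tuple_measure (lebesgue_point R d) k]_(x in
        @tuples_in Lam k `&` (@config_of k @^-1` E)) weight f x)
  / partition_fun f Lam.

(* lambda_eta(y) = lambda * exp (- sum_(x in eta) phi(x, y)) *)
Definition tilted (lam : R) (eta : {fset rpoint R d}) (y : rpoint R d) : \bar R :=
  lam%:E * expeR (- \sum_(x <- eta) phi x y).

Definition restr_activity (f : rpoint R d -> \bar R) (A : set (rpoint R d))
    (y : rpoint R d) : \bar R :=
  f y * (\1_A y)%:E.

End gibbs.

Section boxes.
Context {R : realType}.
Variables (d : nat) (L r : R).

(* N = ceil (L / r), an integer that is nonnegative for L, r > 0 *)
Definition nboxes : nat := `|Num.ceil (L / r)|%N.

Definition vertex := {ffun 'I_d -> 'I_nboxes}.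

Definition domain : set (rpoint R d) :=
  [set x | forall i, 0 <= (tnth x i : R) < L].

Definition box (v : vertex) : set (rpoint R d) :=
  domain `&` [set x | forall i, (v i)%:R * r <= (tnth x i : R) < (v i).+1%:R * r].

Definition region (S : {set vertex}) : set (rpoint R d) :=
  [set x | exists2 v, v \in S & box v x].

(* sup-norm ball: |v_i - w_i| <= k for all i *)
Definition vball (v : vertex) (k : nat) : {set vertex} :=
  [set w : vertex | [forall i, (v i <= w i + k)%N && (w i <= v i + k)%N]]%SET.

Definition bd (S : {set vertex}) : {set vertex} :=
  [set w | (w \notin S) && [exists v in S, w \in vball v 1]]%SET.

Definition upd (S : {set vertex}) (v : vertex) (ell : nat) : {set vertex} :=
  (v |: (vball v ell :\: S))%SET.

End boxes.

Arguments domain {R} d L _.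
Arguments vertex {R} d L r.

Section algorithm.
Context {R : realType} {d : nat}.
Variables (L r : R) (phi : rpoint R d -> rpoint R d -> \bar R) (lam : R)
  (ell : nat).
Local Notation vtx := (vertex d L r).
Local Notation Z eta A := (partition_fun phi (tilted phi lam eta) (region A)).
Implicit Types (S B : {set vtx}) (v : vtx) (eta xi : {fset rpoint R d}).

Definition repulsive_potential : Prop :=
  [/\ measurable_fun [set: rpoint R d * rpoint R d] (fun p => phi p.1 p.2),
      forall x y, phi x y = phi y x,
      forall x y, (0 <= phi x y)%E &
      forall x y, r < eucl_dist x y -> phi x y = 0%E].

(* the infimum in the upper bound on a Bayes filter correction *)
Definition filter_bound S v eta : \bar R :=
  let B := upd S v ell in
  let H := (~: (S :|: B))%SET in
  ereal_inf
    [set (Z (xi `|` restr (region S) eta)%fset (B :\ v)%SET /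
          Z (xi `|` restr (region (S :\ v)%SET) eta)%fset B)%E
    | xi in [set xi : {fset rpoint R d} | configs_in (region H) xi /\
               feasible phi (xi `|` restr (region S) eta)%fset]].

Definition bayes_filter_correction
    (kappa : {set vtx} -> vtx -> {fset rpoint R d} -> R) : Prop :=
  (forall S v eta, configs_in (domain d L) eta -> 0 <= kappa S v eta <= 1) /\
  (forall S v, v \in S ->
     [/\ measurable_fun (configs_in (domain d L)) (kappa S v : config R d -> R),
         forall eta, configs_in (domain d L) eta ->
           kappa S v eta = kappa S v (restr (region S) eta) &
         exists2 eps : R, 0 < eps &
           forall eta, configs_in (domain d L) eta -> feasible phi eta ->
             eps <= kappa S v eta /\
             ((kappa S v eta)%:E <= filter_bound S v eta)%E]).

Variable kappa : {set vtx} -> vtx -> {fset rpoint R d} -> R.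

(* parameter of the Bernoulli variable F_t *)
Definition accept S v eta : \bar R :=
  let B := upd S v ell in
  ((kappa S v eta)%:E *
     (Z (restr (region (bd B)) eta) B /
      Z (restr (region (v |: bd B)%SET) eta) (B :\ v)%SET))%E.

(* law of Y: image under eta |-> eta `&` Lambda_B of the Gibbs measure on
   Lambda with activity lambda_{X \ Lambda_B} 1_{Lambda_B} *)
Definition resample S v eta : set (config R d) -> \bar R :=
  let LB := region (upd S v ell) in
  pushforward
    (gibbs phi
       (restr_activity
          (tilted phi lam (restr (domain d L `\` LB) eta)) LB)
       (domain d L))
    (restr LB : config R d -> config R d).

Section process.
Context {disp : measure_display} {Omega : measurableType disp}.
Variables (P : probability Omega R)
  (S : nat -> Omega -> {set vtx}) (v : nat -> Omega -> vtx)
  (F : nat -> Omega -> bool) (Y X : nat -> Omega -> config R d).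

Inductive history_event (t : nat) : set Omega -> Prop :=
| HistS s S0 of (s <= t)%N : history_event t [set w | S s w = S0]
| HistX s A of (s <= t)%N & measurable A : history_event t (X s @^-1` A)
| Histv s v0 of (s < t)%N : history_event t [set w | v s w = v0]
| HistF s b of (s < t)%N : history_event t [set w | F s w = b]
| HistY s A of (s < t)%N & measurable A : history_event t (Y s @^-1` A).

(* sigma-field of everything drawn before round t *)
Definition history (t : nat) : set_system Omega := <<s history_event t >>.

(* On the event D, the conditional probability of E given the sigma-field
   generated by G and D is f. *)
Definition cond_law (G : set_system Omega) (D E : set Omega)
    (f : Omega -> \bar R) : Prop :=
  forall H, G H -> P (H `&` D `&` E) = (\int[P]_(w in H `&` D) f w)%E.

Record algorithm_process : Prop := AlgorithmProcess {
  process_measS : forall t S0, measurable [set w | S t w = S0] ;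
  process_measv : forall t v0, measurable [set w | v t w = v0] ;
  process_measF : forall t b, measurable [set w | F t w = b] ;
  process_measY : forall t, measurable_fun [set: Omega] (Y t) ;
  process_measX : forall t, measurable_fun [set: Omega] (X t) ;
  process_inX : forall t w, configs_in (domain d L) (X t w) ;
  process_S0 : forall w, S 0 w = [set: vtx]%SET ;
  process_X0 : forall w, X 0 w = fset0 ;
  process_stop : forall t w, S t w = finset.set0 ->
    S t.+1 w = S t w /\ X t.+1 w = X t w ;
  process_v : forall t S0 v0, v0 \in S0 ->
    cond_law (history t) [set w | S t w = S0] [set w | v t w = v0]
      (fun=> ((#|S0|%:R : R)^-1)%:E) ;
  process_F : forall t S0 v0, v0 \in S0 ->
    cond_law (history t) [set w | S t w = S0 /\ v t w = v0]
      [set w | F t w]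
      (fun w => accept S0 v0 (X t w)) ;
  process_Y : forall t S0 v0 A, v0 \in S0 -> measurable A ->
    cond_law (history t) [set w | [/\ S t w = S0, v t w = v0 & F t w]]
      (Y t @^-1` A)
      (fun w => resample S0 v0 (X t w) A) ;
  process_accept : forall t w, S t w != finset.set0 -> F t w ->
    X t.+1 w =
      (restr (~` region (upd (S t w) (v t w) ell)) (X t w) `|` Y t w)%fset /\
    S t.+1 w = (S t w :\ v t w)%SET ;
  process_reject : forall t w, S t w != finset.set0 -> ~~ F t w ->
    X t.+1 w = X t w /\
    S t.+1 w = (S t w :|: bd (upd (S t w) (v t w) ell))%SET
}.

End process.
End algorithm.

Definition cond_prob {R : realType} {disp : measure_display}
    {Omega : measurableType disp} (P : probability Omega R)
    (E D : set Omega) : \bar R :=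
  (P (E `&` D) / P D)%E.

(* Main.v *)
Require Import Defs.
From HB Require Import structures.
From mathcomp Require Import all_boot all_order all_algebra finmap.
From mathcomp Require Import all_classical all_reals all_analysis.
From mathcomp Require Import measurable_realfun.
From mathcomp Require Import ring.
Set Implicit Arguments.
Unset Strict Implicit.
Unset Printing Implicit Defensive.
Import Order.TTheory GRing.Theory Num.Theory.
Local Open Scope classical_set_scope.
Local Open Scope ring_scope.

(** A round leaves the law of the process in the form of some measure on the
configuration in the unresolved region [region S], times the Gibbs kernel
[gspec] on the complement with the former as boundary condition; this is the
invariant [gibbs_outside], stated for an event recording the past choices of
vertices and of acceptance. At time 0 the Gibbs part is trivial, and once
[S] is empty it is the whole law, whence the theorem.

The invariant survives a rejection because the acceptance probability only
depends on the configuration in [S] and the boundary of the update set [B], so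
that the kernel can be split along that boundary (DLR consistency,
[gspec_chain]). It survives an acceptance because the ratio of partition
functions in the acceptance probability cancels both the normalisation of the
resampled configuration and the partition function that appears when the old
configuration in [B :\ v] is integrated out ([gspec_accept]); here one uses
that the range of the potential prevents any interaction between the box of
[v] and the boxes outside both [S] and [B].

The unknown measure is only handled through the functional [Phi] that
integrates nonnegative measurable functions against it
([sigma_functional]). *)

(** * Functionals on nonnegative measurable functions *)

Section nonnegative_functions.
Context {R : realType}.
Local Open Scope ereal_scope.

(** The mass carried by the unresolved part depends on the whole past, so it is never given a
    formula: the invariant only asks that some functional exists, and each factor produced by a
    round (uniform choice, filter, rejection weight) is absorbed into it. This is also why the
    invariant concerns a single branch of the past: the branch is split at every round, in an
    induction on the number of remaining rounds, and functionals of different branches are never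
    added.

    Two obstacles shape the rest. Partition functions integrate over ordered tuples, while the
    process lives on point sets, which forget repetitions; the two are reconciled almost everywhere,
    points being null for Lebesgue measure in positive dimension. Moreover the algorithm is
    specified by conditional laws of events: these must be extended to integrands, by expanding
    nonnegative functions into series of indicators, and the bound by 1 on the acceptance
    probability, the membership of the chosen vertex in [S] and the support of the resampled points
    are obtained only up to null events. *)

Definition nnmeasurable {d} {T : measurableType d} (f : T -> \bar R) : Prop :=
  measurable_fun [set: T] f /\ forall x, 0 <= f x.

(* nonnegative linear functionals on nonnegative measurable functions, i.e.
   integration against an arbitrary measure *)
Record sigma_functional {d} {T : measurableType d}
    (Phi : (T -> \bar R) -> \bar R) : Prop := SigmaFunctional {
  sfun_ge0 : forall f, nnmeasurable f -> 0 <= Phi f ;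
  sfun_series : forall f : nat -> T -> \bar R, (forall k, nnmeasurable (f k)) ->
    Phi (fun x => \sum_(0 <= k <oo) f k x) = \sum_(0 <= k <oo) Phi (f k) ;
  sfunZ : forall (c : R) f, (0 <= c)%R -> nnmeasurable f ->
    Phi (fun x => c%:E * f x) = c%:E * Phi f
}.

(** The factor may be [+oo], since values of functions, and not only real constants, are pulled
    through series. In that case either all terms vanish or some term is positive and both sides are
    [+oo]. *)
Lemma nneseriesZl_ereal (a : \bar R) (u : nat -> \bar R) : 0 <= a ->
  (forall k, 0 <= u k) ->
  \sum_(0 <= k <oo) a * u k = a * \sum_(0 <= k <oo) u k.
Proof.
move=> a0 u0; case: a a0 => [c| |]// a0; first by rewrite nneseriesZl.
have [u00|] := pselect (forall k, u k = 0).
  by rewrite !eseries0 ?mule0// => i _ _; rewrite u00 ?mule0.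
move/existsNP => [k uk].
have uk0 : 0 < u k by rewrite lt_neqAle (u0 k) eq_sym andbT; exact/eqP.
rewrite gt0_mulye; last first.
  apply: lt_le_trans (nneseries_lim_ge k.+1 _) => [|n _ _]; last exact: u0.
  by rewrite big_nat_recr//= (lt_le_trans uk0)// leeDr// sume_ge0.
apply/eqP; rewrite -leye_eq.
apply: le_trans (nneseries_lim_ge k.+1 _) => [|n _ _]; last by rewrite mule_ge0.
rewrite big_nat_recr//= gt0_mulye// addey ?leey//.
rewrite gt_eqF// (@lt_le_trans _ _ 0)// sume_ge0// => i _.
by rewrite mule_ge0.
Qed.

(** Each antidiagonal is padded with zeros to a full series, so that the two summations can be
    interchanged; the column of index [i] then starts at [n = i]. *)
Lemma nneseries_antidiagonal (a : nat -> nat -> \bar R) :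
  (forall i j, 0 <= a i j) ->
  \sum_(0 <= n <oo) \sum_(i < n.+1) a i (n - i)%N =
  \sum_(0 <= i <oo) \sum_(0 <= j <oo) a i j.
Proof.
move=> a0.
transitivity (\sum_(0 <= n <oo) \sum_(0 <= i <oo)
    (if (i <= n)%N then a i (n - i)%N else 0)).
  apply: eq_eseriesr => n _; rewrite [RHS](nneseries_split 0 n.+1); last first.
    by move=> k _; case: ifP.
  rewrite add0n eseries0 ?adde0; last first.
    by move=> i ni _; rewrite leqNgt ni.
  rewrite big_mkord; apply: eq_bigr => i _.
  by rewrite -ltnS ltn_ord.
rewrite nneseries_interchange; last by move=> i j; case: ifP.
apply: eq_eseriesr => i _; rewrite (nneseries_split 0 i); last first.
  by move=> k _; case: ifP.
rewrite big1_seq ?add0e ?add0n; last first.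
  move=> k; rewrite mem_index_iota => /andP[_ /andP[_ ki]].
  by rewrite leqNgt ki.
rewrite -nneseries_addn; last by move=> k; case: ifP.
by apply: eq_eseriesr => k _; rewrite leq_addl addnK.
Qed.

Section basics.
Context {d : measure_display} {T : measurableType d}.
Implicit Types (f g h : T -> \bar R) (Phi : (T -> \bar R) -> \bar R).

Lemma nnmeasurable_indic (A : set T) : measurable A ->
  nnmeasurable (fun x => (\1_A x)%:E : \bar R).
Proof.
move=> mA; split; last by move=> x; rewrite lee_fin indicE; case: (x \in A).
by apply: measurableT_comp; [exact: EFin_measurable|exact: measurable_indic].
Qed.

Lemma nnmeasurable_cst (c : \bar R) : 0 <= c -> nnmeasurable (fun _ : T => c).
Proof. by move=> c0; split => //; exact: measurable_cst. Qed.

Lemma nnmeasurableM f g : nnmeasurable f -> nnmeasurable g ->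
  nnmeasurable (fun x => f x * g x).
Proof.
move=> [mf f0] [mg g0]; split; first exact: emeasurable_funM.
by move=> x; exact: mule_ge0.
Qed.

Lemma nnmeasurableD f g : nnmeasurable f -> nnmeasurable g ->
  nnmeasurable (fun x => f x + g x).
Proof.
move=> [mf f0] [mg g0]; split; first exact: emeasurable_funD.
by move=> x; exact: adde_ge0.
Qed.

Lemma nnmeasurable_series (f : nat -> T -> \bar R) :
  (forall k, nnmeasurable (f k)) ->
  nnmeasurable (fun x => \sum_(0 <= k <oo) f k x).
Proof.
move=> nf; split; last by move=> x; apply: nneseries_ge0 => k _ _; exact: (nf k).2.
apply: (@ge0_emeasurable_sum _ _ _ _ f xpredT).
  by move=> k x _ _; exact: (nf k).2.
by move=> k _; exact: (nf k).1.
Qed.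

Lemma nnmeasurable_comp d' (U : measurableType d') (f : T -> U)
    (g : U -> \bar R) : measurable_fun setT f -> nnmeasurable g ->
  nnmeasurable (fun x => g (f x)).
Proof. by move=> mf [mg g0]; split => //; exact: measurableT_comp. Qed.

Lemma nnmeasurable_prod (I : Type) (r : seq I) (P : pred I)
    (f : I -> T -> \bar R) : (forall i, nnmeasurable (f i)) ->
  nnmeasurable (fun x => \prod_(i <- r | P i) f i x).
Proof.
move=> nf; elim: r => [|i r IH].
  under eq_fun do rewrite big_nil; exact: nnmeasurable_cst.
under eq_fun do rewrite big_cons.
case: (P i) => //; exact: nnmeasurableM.
Qed.

Lemma nnmeasurable_sum (I : Type) (r : seq I) (P : pred I)
    (f : I -> T -> \bar R) : (forall i, nnmeasurable (f i)) ->
  nnmeasurable (fun x => \sum_(i <- r | P i) f i x).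
Proof.
move=> nf; elim: r => [|i r IH].
  under eq_fun do rewrite big_nil; exact: nnmeasurable_cst.
under eq_fun do rewrite big_cons.
case: (P i) => //; exact: nnmeasurableD.
Qed.

Lemma nnmeasurable_expeN f : nnmeasurable f ->
  nnmeasurable (fun x => expeR (- f x)).
Proof.
move=> [mf f0]; split; last by move=> x; exact: expeR_ge0.
(* The indicator corrects the points where [f] is [+oo]: there [fine] returns 0 and the real
   exponential would be 1 instead of 0. *)
have H : (fun x => expeR (- f x)) =
    (fun x => (expR (- fine (f x)))%:E * (\1_(f @^-1` [set~ +oo%E]) x)%:E).
  apply/funext => x; rewrite indicE; case E: (f x) => [r| |].
  - by rewrite mem_set ?mule1//= E.
  - by rewrite memNset ?mule0//= E; apply.
  - by have := f0 x; rewrite E.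
rewrite H; apply: emeasurable_funM; last first.
  apply: (nnmeasurable_indic _).1; rewrite -[X in measurable X]setTI.
  by apply: mf => //; apply: measurableC; exact: emeasurable_set1.
apply: measurableT_comp; first exact: EFin_measurable.
apply: measurableT_comp; first exact: measurable_expR.
apply: measurableT_comp; first exact: oppr_measurable.
exact: measurableT_comp.
Qed.

Lemma sfun0 Phi : sigma_functional Phi -> Phi (fun=> 0) = 0.
Proof.
move=> H; have := sfunZ H (lexx 0%R) (nnmeasurable_cst (lexx 0)).
rewrite [RHS]mul0e => E; rewrite -[RHS]E.
by congr Phi; apply/funext => x; rewrite mule0.
Qed.

(** Finite additivity comes from countable additivity on the sequence [f], [g], 0, 0, ..., once
    homogeneity with the constant 0 has shown that [Phi] vanishes at 0. *)
Lemma sfunD Phi f g : sigma_functional Phi -> nnmeasurable f -> nnmeasurable g ->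
  Phi (fun x => f x + g x) = Phi f + Phi g.
Proof.
move=> H nf ng.
pose u k := if k == 0%N then f else if k == 1%N then g else fun=> 0.
have nu k : nnmeasurable (u k).
  by rewrite /u; do 2 case: ifP => // _; exact: nnmeasurable_cst.
have two (w : nat -> \bar R) : (forall k, 0 <= w k) ->
    (forall k, (1 < k)%N -> w k = 0) -> \sum_(0 <= k <oo) w k = w 0%N + w 1%N.
  move=> w0 w2; rewrite (nneseries_split 0 2)// add0n eseries0 ?adde0.
    by rewrite big_nat_recr//= big_nat1.
  by move=> i /w2.
have := sfun_series H nu; rewrite two; last 2 first.
- by move=> k; exact: (sfun_ge0 H).
- by move=> [|[|k]]// _; rewrite /u/= sfun0.
rewrite {1 2}/u/= => <-; congr Phi; apply/funext => x.
by rewrite two// => [k|[|[|k]]]//; exact: (nu k).2.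
Qed.

(* greedy expansion along the divergent harmonic series *)
Lemma nnmeasurable_indic_series f : nnmeasurable f ->
  exists c : nat -> R, exists A : nat -> set T,
  [/\ forall k, (0 <= c k)%R, forall k, measurable (A k) &
      f = fun x => \sum_(0 <= k <oo) (c k)%:E * (\1_(A k) x)%:E].
Proof.
move=> [mf f0].
pose c k : R := (k.+1%:R^-1)%R.
(* The partial sums: [c k] is added exactly at the points where this does not overshoot [f]. *)
pose s := fix s (k : nat) : T -> \bar R := if k is k'.+1 then
   (fun x => s k' x + (c k')%:E *
        (\1_([set y | (s k' y + (c k')%:E <= f y)%E]) x)%:E) else fun=> 0.
pose A k := [set y | s k y + (c k)%:E <= f y].
have c0 k : (0 <= c k)%R by rewrite invr_ge0.
have msA k : measurable_fun setT (s k) /\ measurable (A k).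
  have mA j : measurable_fun setT (s j) -> measurable (A j).
    move=> mj; rewrite /A -[X in measurable X]setTI.
    by apply: emeasurable_fun_le => //; exact: emeasurable_funD.
  have ms0 : measurable_fun setT (s 0%N) by exact: measurable_cst.
  elim: k => [|k [ms mAk]]; first by split => //; exact: mA.
  have msS : measurable_fun setT (s k.+1).
    apply: emeasurable_funD => //; apply: emeasurable_funM => //.
    exact: (nnmeasurable_indic mAk).1.
  by split => //; exact: mA.
have mA k := (msA k).2.
exists c, A; split => //; apply/funext => x.
pose u k := (c k)%:E * (\1_(A k) x)%:E.
have u0 k : 0 <= u k by rewrite mule_ge0 // lee_fin// indicE; case: (_ \in _).
have sE k : s k x = \sum_(0 <= i < k) u i.
  by elim: k => [|k IH]; rewrite ?big_nil// big_nat_recr//= -IH.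
have sle k : s k x <= f x.
  elim: k => [|k IH] //=; rewrite indicE.
  by case: (boolP (x \in _)) => [/set_mem|_]; rewrite ?mule1// mule0 adde0.
set l := (X in _ = X).
have sl k : s k x <= l by rewrite sE; exact: nneseries_lim_ge.
apply/eqP; rewrite eq_le; apply/andP; split; last first.
  have cu : cvgn (fun n => \sum_(0 <= k < n) u k).
    by apply: is_cvg_nneseries => k _ _; exact: u0.
  apply: (lime_le cu).
  by apply: nearW => k; rewrite -sE.
(* If the sum stayed below [f x] by a gap [e], every term with [c k <= e] would be added, so a tail
   of the harmonic series would be bounded by [l]. *)
rewrite leNgt; apply/negP => lf.
have l0 : 0 <= l by exact: (sl 0%N).
have lfin : l \is a fin_num by rewrite ge0_fin_numE// (lt_le_trans lf)// leey.
have [e e0 He] : exists2 e : R, (0 < e)%R & l + e%:E <= f x.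
  move: lf; rewrite -(fineK lfin); case: (f x) (f0 x) => [r| |]// _.
    rewrite lte_fin => lr; exists (r - fine l)%R; first by rewrite subr_gt0.
    by rewrite -EFinD lee_fin addrC subrK.
  by move=> _; exists 1%R => //; rewrite leey.
have [N HN] : exists N, forall k, (N <= k)%N -> (c k <= e)%R.
  exists (Num.trunc e^-1).+1 => k Nk; rewrite /c.
  rewrite -[leRHS]invrK lef_pV2 ?posrE ?invr_gt0//.
  have := truncnS_gt e^-1; move/ltW/le_trans; apply.
  by rewrite ler_nat (leq_trans Nk).
have inA k : (N <= k)%N -> x \in A k.
  move=> Nk; rewrite inE /A/=; apply: le_trans He.
  by rewrite leeD// lee_fin HN.
apply: (@dvg_harmonic R).
apply: nondecreasing_is_cvgn.
  by apply: nondecreasing_series => k _ _; rewrite ltW//= invr_gt0.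
exists (\sum_(0 <= i < N) c i + fine l)%R => _ [n _ <-].
have H m : (\sum_(0 <= i < N + m) c i <= \sum_(0 <= i < N) c i + fine l)%R.
  rewrite (big_cat_nat _ (n := N))//= ?leq_addr// lerD2l.
  rewrite -lee_fin fineK// -sumEFin.
  apply: (@le_trans _ _ (\sum_(N <= i < N + m) u i)).
    rewrite big_seq [leRHS]big_seq lee_sum// => i; rewrite mem_index_iota => /andP[Ni _].
    by rewrite /u indicE inA// mule1.
  apply: le_trans (sl (N + m)%N); rewrite sE [leRHS](big_cat_nat _ (n := N))//= ?leq_addr//.
  by rewrite leeDr// sume_ge0.
apply: le_trans (H n); rewrite /series/= addnC.
by rewrite [leRHS](big_cat_nat _ (n := n))//= ?leq_addr// lerDl sumr_ge0.
Qed.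

Lemma sigma_functional_mul Phi g : sigma_functional Phi -> nnmeasurable g ->
  sigma_functional (fun f => Phi (fun x => g x * f x)).
Proof.
move=> H ng; split.
- by move=> f nf; apply: (sfun_ge0 H); exact: nnmeasurableM.
- move=> f nf; rewrite -(sfun_series H); last by move=> k; exact: nnmeasurableM.
  congr Phi; apply/funext => x; rewrite nneseriesZl_ereal//; first exact: ng.2.
  by move=> k; exact: (nf k).2.
- move=> c f c0 nf; rewrite -(sfunZ H)//; last exact: nnmeasurableM.
  by congr Phi; apply/funext => x; rewrite muleCA.
Qed.

Lemma sigma_functionalZ Phi (c : R) : (0 <= c)%R -> sigma_functional Phi ->
  sigma_functional (fun f => c%:E * Phi f).
Proof.
move=> c0 H; split.
- by move=> f nf; rewrite mule_ge0// (sfun_ge0 H).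
- move=> f nf; rewrite (sfun_series H)// -nneseriesZl//.
  by move=> i _; exact: (sfun_ge0 H).
- by move=> a f a0 nf; rewrite (sfunZ H)// muleCA.
Qed.

End basics.

Lemma sigma_functional_bind d d' (T : measurableType d) (U : measurableType d')
    (Phi : (T -> \bar R) -> \bar R) (K : T -> (U -> \bar R) -> \bar R) :
  sigma_functional Phi -> (forall x, sigma_functional (K x)) ->
  (forall f, nnmeasurable f -> nnmeasurable (K ^~ f)) ->
  sigma_functional (fun f => Phi (fun x => K x f)).
Proof.
move=> H HK mK; split.
- by move=> f nf; apply: (sfun_ge0 H); exact: mK.
- move=> f nf; rewrite -(sfun_series H); last by move=> k; exact: mK.
  by congr Phi; apply/funext => x; rewrite (sfun_series (HK x)).
- move=> c f c0 nf; rewrite -(sfunZ H)//; last exact: mK.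
  by congr Phi; apply/funext => x; rewrite (sfunZ (HK x)).
Qed.

Lemma sigma_functional_comp d d' (T : measurableType d) (U : measurableType d')
    (Phi : (T -> \bar R) -> \bar R) (m : T -> U) :
  measurable_fun setT m -> sigma_functional Phi ->
  sigma_functional (fun f => Phi (fun x => f (m x))).
Proof.
move=> mm H; have nm f : nnmeasurable f -> nnmeasurable (fun x => f (m x)).
  exact: nnmeasurable_comp.
split.
- by move=> f nf; apply: (sfun_ge0 H); exact: nm.
- by move=> f nf; rewrite (sfun_series H)// => k; exact: nm.
- by move=> c f c0 nf; rewrite (sfunZ H)//; exact: nm.
Qed.

(** * From probabilities of events to integrals and joint laws *)

Section laws.
Context {dO : measure_display} {Om : measurableType dO} (P : probability Om R).

(** Both sides respect series and nonnegative real factors, so agreement on events suffices: [h] is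
    a series of multiples of indicators. *)
Lemma sigma_functional_law d (T : measurableType d) (D : set Om) (X : Om -> T)
    (Psi : (T -> \bar R) -> \bar R) :
  measurable D -> measurable_fun setT X -> sigma_functional Psi ->
  (forall A, measurable A -> P (D `&` X @^-1` A) = Psi (fun x => (\1_A x)%:E)) ->
  forall h, nnmeasurable h -> \int[P]_(w in D) h (X w) = Psi h.
Proof.
move=> mD mX HPsi HP h /nnmeasurable_indic_series[c [A [c0 mA ->]]].
have nI k : nnmeasurable (fun x => (\1_(A k) x)%:E : \bar R).
  exact: nnmeasurable_indic.
have nA k : nnmeasurable (fun x => (c k)%:E * (\1_(A k) x)%:E).
  by apply: nnmeasurableM => //; apply: nnmeasurable_cst; rewrite lee_fin.
have nX k : nnmeasurable (fun w => (\1_(A k) (X w))%:E : \bar R).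
  exact: (nnmeasurable_comp mX (nI k)).
rewrite (sfun_series HPsi)// integral_nneseries//; last 2 first.
- move=> k; apply: measurable_funTS; exact: (nnmeasurable_comp mX (nA k)).1.
- by move=> k w _; exact: (nA k).2.
apply: eq_eseriesr => k _; rewrite (sfunZ HPsi)// -HP//.
rewrite ge0_integralZl//=; last 2 first.
- by apply: measurable_funTS; exact: (nX k).1.
- by rewrite lee_fin.
congr *%E; transitivity (\int[P]_(w in D) (\1_(X @^-1` A k) w)%:E).
  by apply: eq_integral => w _; rewrite !indicE; congr ((_ : bool)%:R)%:E.
by rewrite integral_indic// 1?setIC// -[X in measurable X]setTI; exact: mX.
Qed.

(** Dynkin's lemma on the rectangles, which are stable under intersection and generate the product
    sigma-field. *)
Lemma sigma_functional_joint_law d1 d2 (T1 : measurableType d1)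
    (T2 : measurableType d2) (D : set Om) (X : Om -> T1) (Y : Om -> T2)
    (Psi : (T1 * T2 -> \bar R) -> \bar R) :
  measurable D -> measurable_fun setT X -> measurable_fun setT Y ->
  sigma_functional Psi ->
  (forall A B, measurable A -> measurable B ->
     P (D `&` X @^-1` A `&` Y @^-1` B) = Psi (fun p => (\1_(A `*` B) p)%:E)) ->
  forall C, measurable C ->
    P (D `&` [set w | C (X w, Y w)]) = Psi (fun p => (\1_C p)%:E).
Proof.
move=> mD mX mY HPsi HR C.
have mZ : measurable_fun setT (fun w => (X w, Y w)) by exact: measurable_fun_pair.
have mpre B : measurable B -> measurable (D `&` [set w | B (X w, Y w)]).
  move=> mB; apply: measurableI => //; rewrite -[X in measurable X]setTI.
  exact: mZ.
have HT : P (D `&` [set w | setT (X w, Y w)]) =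
    Psi (fun p => (\1_(setT : set (T1 * T2)) p)%:E).
  have := HR setT setT measurableT measurableT; rewrite setXTT => <-.
  by congr (P _); rewrite !preimage_setT setIT.
have Pfin B : measurable B -> P B \is a fin_num by move=> ?; exact: fin_num_measure.
rewrite measurable_prod_measurableType => mC.
apply: (dynkin_induction (measurable_prod_measurableType T1 T2)
  (P := fun C => P (D `&` [set w | C (X w, Y w)]) = Psi (fun p => (\1_C p)%:E))) mC.
- move=> _ _ [A1 mA1 [B1 mB1 <-]] [A2 mA2 [B2 mB2 <-]].
  exists (A1 `&` A2); first exact: measurableI.
  by exists (B1 `&` B2); [exact: measurableI|rewrite setXI].
- exact: HT.
- by move=> _ [A mA [B mB <-]]; rewrite -HR//; congr (P _); rewrite -setIA.
- move=> B mB HB.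
  have eqn : Psi (fun p => (\1_(setT : set (T1 * T2)) p)%:E) =
      Psi (fun p => (\1_B p)%:E) + Psi (fun p => (\1_(~` B) p)%:E).
    rewrite -sfunD//; try (apply: nnmeasurable_indic => //; exact: measurableC).
    congr Psi; apply/funext => p; rewrite !indicE -EFinD in_setT in_setC.
    by case: (p \in B); rewrite ?addr0 ?add0r.
  have PT : P (D `&` [set w | setT (X w, Y w)]) =
      P (D `&` [set w | B (X w, Y w)]) + P (D `&` [set w | (~` B) (X w, Y w)]).
    rewrite -measureU//; try (apply: mpre => //; exact: measurableC).
      by congr (P _); apply/seteqP; split => w /=; [have [] := pselect (B (X w, Y w)); tauto|tauto].
    by apply/seteqP; split => w //= [[_ ?] [_ ?]].
  (* Passing to the complement is a subtraction. The functional may be infinite in general, but on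
     [B] it equals a probability. *)
  have fB : Psi (fun p => (\1_B p)%:E) \is a fin_num by rewrite -HB Pfin//; exact: mpre.
  have := HT; rewrite eqn PT HB.
  move/(congr1 (fun z => z - Psi (fun p => (\1_B p)%:E))).
  by rewrite addeAC subee// add0e addeAC subee// add0e.
- move=> F mF tF HF.
  rewrite (_ : _ `&` _ = \bigcup_k (D `&` [set w | F k (X w, Y w)])); last first.
    apply/seteqP; split => [w [Dw [k _ Fk]]|w [k _ [Dw Fk]]]; first by exists k.
    by split => //; exists k.
  rewrite measure_bigcup//=; last 2 first.
  - by move=> k _; exact: mpre.
  - move/trivIsetP : tF => tF; apply/trivIsetP => i j _ _ ij.
    apply/seteqP; split => w //= [[_ Fi] [_ Fj]].
    by have := tF i j I I ij; rewrite predeqE => /(_ (X w, Y w)) [H _]; apply: H.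
  transitivity (\sum_(0 <= k <oo) Psi (fun p => (\1_(F k) p)%:E)).
    by rewrite eseries_mkcond; apply: eq_eseriesr => k _; rewrite in_setT HF.
  rewrite -(sfun_series HPsi); last by move=> k; exact: nnmeasurable_indic.
  by congr Psi; apply/funext => p; rewrite (indic_bigcup p tF).
Qed.

End laws.
End nonnegative_functions.

(** * Iterated integrals of symmetric functions of sequences *)

Section iterated_integrals.
Context {R : realType} {d : measure_display} {T : measurableType d}.
Variable mu : {sigma_finite_measure set T -> \bar R}.
Local Open Scope ereal_scope.
Implicit Types (p q : T -> \bar R) (F G : seq T -> \bar R).

(** Integrands are functions of sequences, with measurability asked on tuples of every length:
    peeling off a point or concatenating then needs no cast between tuple types. *)
Definition seq_nnmeasurable F : Prop :=
  forall n, nnmeasurable (fun x : n.-tuple T => F x).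

Definition seq_symmetric F : Prop := forall s s', perm_eq s s' -> F s = F s'.

(** The integral of [F] against the [n]-th power of the measure with density [p]. The iterated form
    allows proofs one point at a time; [tuple_integral] relates it to the product measure. *)
Fixpoint itint p n F : \bar R :=
  if n is m.+1 then \int[mu]_z (p z * itint p m (fun s => F (z :: s)))
  else F [::].

Lemma measurable_tuple_rcons n :
  measurable_fun [set: n.-tuple T * T] (fun x => [tuple of rcons x.1 x.2]).
Proof.
apply/measurable_fun_tnthP => i.
have [lin|lin] := ltnP i n.
  rewrite (_ : _ \o _ = (fun x => tnth x (Ordinal lin)) \o fst); last first.
    apply/funext => -[x z] /=.
    rewrite (tnth_nth z) (tnth_nth z) /= nth_rcons size_tuple lin//.
  by apply: measurableT_comp; [exact: measurable_tnth|exact: measurable_fst].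
rewrite (_ : _ \o _ = snd); first exact: measurable_snd.
apply/funext => -[x z] /=; rewrite (tnth_nth z) /= nth_rcons size_tuple.
by rewrite ltnNge lin/= eqn_leq lin andbT -ltnS ltn_ord.
Qed.

Lemma seq_nnmeasurable_pair F n : seq_nnmeasurable F ->
  nnmeasurable (fun x : T * n.-tuple T => F (x.1 :: x.2)).
Proof.
move=> nF.
have m : measurable_fun [set: T * n.-tuple T] (fun x => [the n.+1.-tuple T of x.1 :: x.2]).
  by apply: measurable_cons; [exact: measurable_fst|exact: measurable_snd].
exact: (nnmeasurable_comp m (nF n.+1)).
Qed.

Lemma seq_nnmeasurable_cons F z : seq_nnmeasurable F ->
  seq_nnmeasurable (fun s => F (z :: s)).
Proof.
move=> nF n; have m : measurable_fun setT (fun x : n.-tuple T => (z, x)).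
  by apply: measurable_fun_pair; [exact: measurable_cst|exact: measurable_id].
exact: (nnmeasurable_comp m (seq_nnmeasurable_pair n nF)).
Qed.

Lemma seq_nnmeasurable_catl F u : seq_nnmeasurable F ->
  seq_nnmeasurable (fun s => F (u ++ s)).
Proof.
elim: u F => [//|z u IH] F nF.
exact: (IH _ (seq_nnmeasurable_cons z nF)).
Qed.

Lemma seq_nnmeasurable_prod q : nnmeasurable q ->
  seq_nnmeasurable (fun s => \prod_(z <- s) q z).
Proof.
move=> nq k; under eq_fun do rewrite big_tuple.
apply: nnmeasurable_prod => i.
exact: (nnmeasurable_comp (measurable_tnth i) nq).
Qed.

Lemma itint_ge0 p n F : (forall z, 0 <= p z) -> (forall s, 0 <= F s) ->
  0 <= itint p n F.
Proof.
move=> p0; elim: n F => [|n IH] F F0 //=.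
by apply: integral_ge0 => z _; rewrite mule_ge0// IH.
Qed.

Lemma seq_nnmeasurable_ge0 F s : seq_nnmeasurable F -> 0 <= F s.
Proof. by move=> nF; have := (nF (size s)).2 (in_tuple s). Qed.

(** The prefix [u] grows by one point per induction step, which leaves the measurability of a
    section integral, as in Tonelli's theorem. *)
Lemma seq_nnmeasurable_itint p n F : nnmeasurable p -> seq_nnmeasurable F ->
  seq_nnmeasurable (fun u => itint p n (fun s => F (u ++ s))).
Proof.
move=> np nF; elim: n => [|n IH] k /=.
  by under eq_fun do rewrite cats0; exact: nF.
pose f (x : k.-tuple T * T) := p x.2 * itint p n (fun s => F (rcons x.1 x.2 ++ s)).
have nf : nnmeasurable f.
  apply: nnmeasurableM; first exact: (nnmeasurable_comp measurable_snd np).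
  exact: (nnmeasurable_comp (@measurable_tuple_rcons k) (IH k.+1)).
have -> : (fun u : k.-tuple T =>
    \int[mu]_z (p z * itint p n (fun s => F (u ++ z :: s)))) = fubini_F mu f.
  apply/funext => u; apply: eq_integral => z _; rewrite /f/=; congr *%E.
  by congr itint; apply/funext => s; rewrite cat_rcons.
split; first exact: measurable_fun_fubini_tonelli_F nf.1 nf.2.
by move=> u; apply: integral_ge0 => z _; exact: nf.2.
Qed.

Lemma nnmeasurable_itint_cons p n F : nnmeasurable p -> seq_nnmeasurable F ->
  nnmeasurable (fun z => itint p n (fun s => F (z :: s))).
Proof.
move=> np nF.
have m : measurable_fun setT (fun z : T => [the 1.-tuple T of [:: z]]).
  apply/measurable_fun_tnthP => i; rewrite (_ : _ \o _ = id).
    exact: measurable_id.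
  by apply/funext => z; rewrite ord1.
exact: (nnmeasurable_comp m (seq_nnmeasurable_itint n np nF 1%N)).
Qed.

Lemma nnmeasurable_itint_cons2 p n F : nnmeasurable p -> seq_nnmeasurable F ->
  nnmeasurable (fun x : T * T => itint p n (fun s => F (x.1 :: x.2 :: s))).
Proof.
move=> np nF.
have m : measurable_fun setT (fun x : T * T => [the 2.-tuple T of [:: x.1; x.2]]).
  apply/measurable_fun_tnthP => i; case: i => -[|[|//]] i2.
    by rewrite (_ : _ \o _ = fst)//; exact: measurable_fst.
  by rewrite (_ : _ \o _ = snd)//; exact: measurable_snd.
exact: (nnmeasurable_comp m (seq_nnmeasurable_itint n np nF 2%N)).
Qed.

Lemma itintZ p n c F : nnmeasurable p -> 0 <= c -> seq_nnmeasurable F ->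
  itint p n (fun s => c * F s) = c * itint p n F.
Proof.
move=> np c0; elim: n F => [//|n IH] F nF /=.
have nI := nnmeasurable_itint_cons n np nF.
have npI := nnmeasurableM np nI.
rewrite -ge0_integralZl//; [|exact: npI.1|by move=> z _; exact: npI.2].
apply: eq_integral => z _; rewrite IH; last exact: seq_nnmeasurable_cons.
exact: muleCA.
Qed.

Lemma itint_series p n (F : nat -> seq T -> \bar R) : nnmeasurable p ->
  (forall k, seq_nnmeasurable (F k)) ->
  itint p n (fun s => \sum_(0 <= k <oo) F k s) =
  \sum_(0 <= k <oo) itint p n (F k).
Proof.
move=> np; elim: n F => [//|n IH] F nF /=.
have nI k : nnmeasurable (fun z => p z * itint p n (fun s => F k (z :: s))).
  by apply: nnmeasurableM => //; exact: nnmeasurable_itint_cons.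
rewrite -integral_nneseries//; last 2 first.
- by move=> k; exact: (nI k).1.
- by move=> k z _; exact: (nI k).2.
apply: eq_integral => z _.
rewrite (IH (fun k s => F k (z :: s))); last first.
  by move=> k; exact: seq_nnmeasurable_cons.
rewrite nneseriesZl_ereal//; first exact: np.2.
by move=> k; exact: (nnmeasurable_itint_cons n np (nF k)).2.
Qed.

Lemma itintM p q n F : nnmeasurable p -> nnmeasurable q -> seq_nnmeasurable F ->
  itint (fun z => p z * q z) n F =
  itint p n (fun s => (\prod_(z <- s) q z) * F s).
Proof.
move=> np nq; elim: n F => [|n IH] F nF /=; first by rewrite big_nil mul1e.
apply: eq_integral => z _; have nFz := seq_nnmeasurable_cons z nF.
have nP : seq_nnmeasurable (fun s => (\prod_(y <- s) q y) * F (z :: s)).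
  by move=> k; apply: nnmeasurableM => //; exact: seq_nnmeasurable_prod.
rewrite (IH _ nFz) -muleA -(itintZ n np (nq.2 z) nP).
by congr (_ * itint _ _ _); apply/funext => s; rewrite big_cons muleA.
Qed.

Lemma tuple_integral p n F : nnmeasurable p -> seq_nnmeasurable F ->
  \int[tuple_measure mu n]_x ((\prod_(z <- x) p z) * F x) = itint p n F.
Proof.
move=> np; elim: n F => [|n IH] F nF.
  rewrite integral_dirac//=.
    by rewrite diracT big_nil !mul1e.
  rewrite (_ : (fun x => _) = fun x : 0.-tuple T => F x); first exact: (nF 0%N).1.
  by apply/funext => x; rewrite tuple0/= big_nil mul1e.
have nP k : nnmeasurable (fun x : k.-tuple T => (\prod_(z <- x) p z) * F x).
  by apply: nnmeasurableM => //; exact: seq_nnmeasurable_prod.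
rewrite ge0_integral_pushforward//; last 3 first.
- exact: measurable_pair_cons.
- exact: (nP n.+1).1.
- by move=> x _; exact: (nP n.+1).2.
have nQ := nnmeasurable_comp (@measurable_pair_cons _ T n) (nP n.+1).
rewrite preimage_setT fubini_tonelli1//; [|exact: nQ.1|exact: nQ.2].
apply: eq_integral => z _; rewrite /fubini_F.
change (\int[tuple_measure mu n]_y ((\prod_(x <- z :: y) p x) * F (z :: y)) =
  p z * itint p n (fun s => F (z :: s))).
have nFz := seq_nnmeasurable_cons z nF.
rewrite -IH// -ge0_integralZl//; last 3 first.
- exact: (nnmeasurableM (seq_nnmeasurable_prod np n) (nFz n)).1.
- move=> x _; rewrite mule_ge0//; last exact: seq_nnmeasurable_ge0.
  by apply: prode_ge0 => i _; exact: np.2.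
- exact: np.2.
by apply: eq_integral => x _; rewrite big_cons muleA.
Qed.

(** Tonelli moves the point [z] past one integrated point at a time; symmetry of [F] lets the two
    leading arguments be exchanged. *)
Lemma itint_swap p q n F : nnmeasurable p -> nnmeasurable q ->
  seq_nnmeasurable F -> seq_symmetric F ->
  \int[mu]_z (q z * itint p n (fun s => F (z :: s))) =
  itint p n (fun s => \int[mu]_z (q z * F (z :: s))).
Proof.
move=> np nq; elim: n F => [//|n IH] F nF sF /=.
pose f (x : T * T) := q x.1 * (p x.2 * itint p n (fun s => F (x.1 :: x.2 :: s))).
have nf : nnmeasurable f.
  apply: nnmeasurableM; first exact: (nnmeasurable_comp measurable_fst nq).
  apply: nnmeasurableM; first exact: (nnmeasurable_comp measurable_snd np).
  exact: nnmeasurable_itint_cons2.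
have nIz z : nnmeasurable (fun y => p y * itint p n (fun s => F (z :: y :: s))).
  apply: nnmeasurableM => //.
  exact: (nnmeasurable_itint_cons n np (seq_nnmeasurable_cons z nF)).
have sFz y : seq_symmetric (fun s => F (y :: s)).
  by move=> s s' ss'; apply: sF; rewrite perm_cons.
transitivity (\int[mu]_z \int[mu]_y f (z, y)).
  apply: eq_integral => z _; rewrite -ge0_integralZl//.
  - exact: (nIz z).1.
  - by move=> y _; exact: (nIz z).2.
  - exact: nq.2.
rewrite fubini_tonelli//; [|exact: nf.1|exact: nf.2].
have FC z y s : F [:: z, y & s] = F [:: y, z & s].
  by apply: sF; rewrite -[[:: z, y & s]]/([:: z] ++ [:: y] ++ s) perm_catCA.
apply: eq_integral => y _.
have -> : itint p n (fun s => \int[mu]_z (q z * F [:: z, y & s])) =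
    \int[mu]_z (q z * itint p n (fun s => F [:: y, z & s])).
  rewrite (IH (fun s => F (y :: s)))//; last exact: seq_nnmeasurable_cons.
  congr itint; apply/funext => s; apply: eq_integral => z _.
  by rewrite FC.
have nqI : nnmeasurable (fun z => q z * itint p n (fun s => F (y :: z :: s))).
  apply: nnmeasurableM => //.
  exact: (nnmeasurable_itint_cons n np (seq_nnmeasurable_cons y nF)).
rewrite -ge0_integralZl//; last 3 first.
- exact: nqI.1.
- by move=> z _; exact: nqI.2.
- exact: np.2.
apply: eq_integral => z _; rewrite /f/= muleCA; congr (_ * (_ * itint _ _ _)).
by apply/funext => s; rewrite FC.
Qed.

(** The binomial theorem for product measures: every point is integrated against [p] or against [q],
    and by symmetry only the number of points of each kind matters. The induction is Pascal's
    rule. *)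
Lemma itint_add p q n F : nnmeasurable p -> nnmeasurable q ->
  seq_nnmeasurable F -> seq_symmetric F ->
  itint (fun z => p z + q z) n F =
  \sum_(i < n.+1) ('C(n, i)%:R)%:E *
     itint p i (fun s => itint q (n - i) (fun s' => F (s ++ s'))).
Proof.
move=> np nq; elim: n F => [|n IH] F nF sF.
  by rewrite big_ord1/= bin0 mul1e.
have sFz y : seq_symmetric (fun s => F (y :: s)).
  by move=> s s' ss'; apply: sF; rewrite perm_cons.
pose D i j G := itint p i (fun s => itint q j (fun s' => G (s ++ s'))).
have nG j : seq_nnmeasurable (fun s => itint q j (fun s' => F (s ++ s'))).
  exact: seq_nnmeasurable_itint.
have D0 i j : 0 <= D i j F.
  by apply: itint_ge0 => [z|s]; [exact: np.2|exact: (seq_nnmeasurable_ge0 s (nG j))].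
have Dp i j : \int[mu]_z (p z * D i j (fun s => F (z :: s))) = D i.+1 j F by [].
(* A new point of the first kind is already in front; one of the second kind has to be moved behind
   the [i] points of the first kind, which is where [itint_swap] enters. *)
have Dq i j : \int[mu]_z (q z * D i j (fun s => F (z :: s))) = D i j.+1 F.
  have sG : seq_symmetric (fun s => itint q j (fun s' => F (s ++ s'))).
    move=> s s' ss'; congr itint; apply/funext => u; apply: sF.
    by rewrite perm_cat2r.
  rewrite [LHS](itint_swap i np nq (nG j) sG); congr itint; apply/funext => s /=.
  apply: eq_integral => z _; congr (_ * itint _ _ _); apply/funext => u.
  by apply: sF; rewrite -cat1s -[z :: u]cat1s perm_catCA.
have nD i j : nnmeasurable (fun z => D i j (fun s => F (z :: s))).
  exact: (nnmeasurable_itint_cons i np (nG j)).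
have nc k : (0 : \bar R) <= (k%:R)%:E by rewrite lee_fin.
transitivity (\sum_(i < n.+1) ('C(n, i)%:R)%:E * (D i.+1 (n - i)%N F + D i (n - i).+1 F)).
  rewrite /=; transitivity (\int[mu]_z \sum_(i < n.+1) (('C(n, i)%:R)%:E *
      (p z * D i (n - i)%N (fun s => F (z :: s)) +
       q z * D i (n - i)%N (fun s => F (z :: s))))).
    apply: eq_integral => z _; rewrite IH//; last exact: seq_nnmeasurable_cons.
    rewrite ge0_sume_distrr; last first.
      by move=> i _; rewrite mule_ge0//; exact: (nD _ _).2.
    apply: eq_bigr => i _; rewrite muleCA; congr *%E.
    by rewrite ge0_muleDl//; [exact: np.2|exact: nq.2].
  have nS (i : 'I_n.+1) : nnmeasurable (fun z =>
      p z * D i (n - i)%N (fun s => F (z :: s)) +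
       q z * D i (n - i)%N (fun s => F (z :: s))).
    by apply: nnmeasurableD; apply: nnmeasurableM.
  rewrite ge0_integral_sum//; last 2 first.
  - by move=> i; apply: (nnmeasurableM _ (nS i)).1; exact: nnmeasurable_cst.
  - by move=> i z _; rewrite mule_ge0//; exact: (nS i).2.
  apply: eq_bigr => i _; rewrite ge0_integralZl//; last 2 first.
  - exact: (nS i).1.
  - by move=> z _; exact: (nS i).2.
  congr *%E; rewrite ge0_integralD ?Dp ?Dq//.
  - by move=> z _; rewrite mule_ge0//; [exact: np.2|exact: (nD _ _).2].
  - exact: (nnmeasurableM np (nD _ _)).1.
  - by move=> z _; rewrite mule_ge0//; [exact: nq.2|exact: (nD _ _).2].
  - exact: (nnmeasurableM nq (nD _ _)).1.
pose b i := D i (n.+1 - i)%N F.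
have b0 i : 0 <= b i by exact: D0.
rewrite (eq_bigr (fun i : 'I_n.+1 =>
    ('C(n, i)%:R)%:E * b i.+1 + ('C(n, i)%:R)%:E * b i)); last first.
  move=> i _; rewrite ge0_muleDr// /b subSS subSn//.
  by rewrite -ltnS ltn_ord.
rewrite -[RHS]/(\sum_(i < n.+2) ('C(n.+1, i)%:R)%:E * b i).
clearbody b; rewrite big_split/= [RHS]big_ord_recl.
rewrite [X in _ = _ + X](eq_bigr (fun i : 'I_n.+1 => ('C(n, i.+1)%:R)%:E * b i.+1
   + ('C(n, i)%:R)%:E * b i.+1)); last first.
  by move=> i _; rewrite lift0 binS natrD EFinD ge0_muleDl.
rewrite big_split/= addeA [RHS]addeC; congr (_ + _).
transitivity (\sum_(i < n.+2) ('C(n, i)%:R)%:E * b i).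
  by rewrite [RHS]big_ord_recr/= bin_small ?leqnn// [X in _ = _ + X]mul0e adde0.
by rewrite big_ord_recl/= !bin0.
Qed.

(** In the absence of atoms, a new point almost surely avoids the finitely many points already
    placed, so sequences with repetitions are negligible; so are those with a point where the
    density vanishes. *)
Lemma itint_uniq p n F G : (forall x : T, measurable [set x]) ->
  (forall x, mu [set x] = 0) -> nnmeasurable p ->
  seq_nnmeasurable F -> seq_nnmeasurable G ->
  (forall s, uniq s -> (forall z, z \in s -> p z != 0) -> F s = G s) ->
  itint p n F = itint p n G.
Proof.
move=> m1 mu1 np nF nG FG.
(* The induction has to remember the points already integrated: [pre] lists them, and agreement is
   required only on sequences that avoid them. *)
suff H : forall pre : seq T, uniq pre ->
    (forall s, uniq (s ++ pre) -> (forall z, z \in s -> p z != 0) -> F s = G s) ->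
    itint p n F = itint p n G.
  by apply: (H [::]) => // s; rewrite cats0; exact: FG.
elim: n F G nF nG {FG} => [|n IH] F G nF nG pre upre FG /=; first exact: FG.
have [mpre mupre] : measurable [set z | z \in pre] /\ mu [set z | z \in pre] = 0.
  elim: pre {upre FG} => [|y pre [m0 mu0]].
    by rewrite (_ : [set _ | _] = set0)//; apply/seteqP; split.
  rewrite (_ : [set z | z \in y :: pre] = [set y] `|` [set z | z \in pre]).
    split; first exact: measurableU.
    apply/eqP; rewrite -measure_le0 (le_trans (measureU2 _ _ _))//.
    by rewrite [X in X + _]mu1 [X in _ + X]mu0 adde0.
  apply/seteqP; split => z /=; rewrite inE.
    by case/orP => [/eqP|]; [left|right].
  by case => [->|->]; rewrite ?eqxx ?orbT.
apply: ge0_ae_eq_integral => //.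
- exact: (nnmeasurableM np (nnmeasurable_itint_cons n np nF)).1.
- exact: (nnmeasurableM np (nnmeasurable_itint_cons n np nG)).1.
- by move=> z _; exact: (nnmeasurableM np (nnmeasurable_itint_cons n np nF)).2.
- by move=> z _; exact: (nnmeasurableM np (nnmeasurable_itint_cons n np nG)).2.
exists [set z | z \in pre]; split => //= z Hz; apply/negP => /negP zpre.
apply: Hz => _; have [->|pz] := eqVneq (p z) 0; first by rewrite !mul0e.
congr *%E; apply: (IH _ _ _ _ (z :: pre)) => //.
- exact: seq_nnmeasurable_cons.
- exact: seq_nnmeasurable_cons.
- by rewrite cons_uniq zpre.
move=> s us ps; apply: FG.
  rewrite -(perm_uniq (s1 := s ++ z :: pre))//.
  by rewrite -cat1s perm_catCA.
by move=> y; rewrite inE => /orP[/eqP ->//|]; exact: ps.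
Qed.

End iterated_integrals.

(** * Measurability on the space of configurations *)

Section config_measurability.
Context {R : realType} {d : nat}.
Local Notation pt := (rpoint R d).
Local Notation cfg := (config R d).

Lemma in_restr (A : set pt) (eta : {fset pt}) x :
  (x \in restr A eta) = (x \in eta) && (x \in A).
Proof. by rewrite /restr !inE. Qed.

Lemma restrI (A B : set pt) (eta : {fset pt}) :
  restr A (restr B eta) = restr (A `&` B) eta.
Proof.
by apply/fsetP => x; rewrite !in_restr in_setI -andbA [(x \in B) && _]andbC.
Qed.

Lemma restrU (A : set pt) (eta xi : {fset pt}) :
  restr A (eta `|` xi)%fset = (restr A eta `|` restr A xi)%fset.
Proof. by apply/fsetP => x; rewrite !(in_restr, inE) andb_orl. Qed.

Lemma measurable_count (B : set pt) (Q : set nat) : measurable B ->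
  measurable [set eta : cfg | Q #|` restr B eta|].
Proof.
move=> mB; rewrite (_ : [set eta | _] =
    \bigcup_(k in Q) [set eta : cfg | #|` restr B eta| = k]); last first.
  by apply/seteqP; split => [eta Qe|eta [k Qk /= ->]]//; exists #|` restr B eta|.
apply: bigcup_measurable => k _; apply: sub_sigma_algebra.
by exists B => //; exists k.
Qed.

Lemma measurable_config_fun d' (U : measurableType d') (f : U -> cfg) :
  (forall B k, measurable B ->
     measurable [set u | #|` restr B (f u : {fset pt})| = k]) ->
  measurable_fun setT f.
Proof.
move=> H; apply: (@measurability _ _ U (config R d) setT f (@counting_events R d) erefl).
by move=> _ [_ [B mB [k ->]] <-]; rewrite setTI; exact: H.
Qed.

Lemma measurable_restr (A : set pt) : measurable A ->
  measurable_fun setT (restr A : cfg -> cfg).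
Proof.
move=> mA; apply: measurable_config_fun => B k mB.
under eq_set do rewrite restrI.
by apply: (@measurable_count _ [set k]); exact: measurableI.
Qed.

(** Disjointness makes the counts add up, so that an event on the count of the union is a finite
    union of rectangles; common points would be counted twice. *)
Lemma measurable_restrU (A B : set pt) : measurable A -> measurable B ->
  A `&` B = set0 ->
  measurable_fun setT (fun p : cfg * cfg => (restr A p.1 `|` restr B p.2)%fset : cfg).
Proof.
move=> mA mB AB; apply: measurable_config_fun => C k mC.
rewrite (_ : [set u | _] = \bigcup_(j in [set j | (j <= k)%N])
    ([set eta : cfg | #|` restr (C `&` A) eta| = j] `*`
     [set eta : cfg | #|` restr (C `&` B) eta| = k - j]%N)); last first.
  have card (p : cfg * cfg) :
      #|` restr C (restr A p.1 `|` restr B p.2)%fset| =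
      (#|` restr (C `&` A) p.1| + #|` restr (C `&` B) p.2|)%N.
    rewrite restrU !restrI; apply/eqP.
    rewrite (leq_card_fsetU _ _); apply/fdisjointP => x.
    rewrite !in_restr => /andP[_ /set_mem [_ Ax]]; apply/negP => /andP[_ /set_mem [_ Bx]].
    by have : (A `&` B) x by []; rewrite AB.
  apply/seteqP; split => -[eta xi]; move: (card (eta, xi)) => /= ->.
    move=> <-; exists #|` restr (C `&` A) eta|.
      exact: leq_addr.
    by split => //=; rewrite addKn.
  by move=> [j jk [/= -> ->]]; rewrite subnKC.
apply: bigcup_measurable => j _; apply: measurableX.
  by apply: (@measurable_count _ [set j]); exact: measurableI.
by apply: (@measurable_count _ [set (k - j)%N]); exact: measurableI.
Qed.

Lemma measurable_pt_eq d' (U : measurableType d') (f g : U -> pt) :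
  measurable_fun setT f -> measurable_fun setT g ->
  measurable [set u | f u = g u].
Proof.
move=> mf mg; rewrite (_ : [set u | _] = \bigcap_(i in [set: 'I_d])
    [set u | (tnth (f u) i : R) = (tnth (g u) i : R)]); last first.
  apply/seteqP; split => [u /= fg i _ /=|u H]; first by rewrite fg.
  by apply: eq_from_tnth => i; exact: (H i I).
apply: fin_bigcap_measurable => [|i _]; first exact: finite_finset.
have mi (h : U -> pt) : measurable_fun setT h ->
    measurable_fun setT (fun u => tnth (h u) i : measurableTypeR R).
  by move=> mh; apply: (measurableT_comp (measurable_tnth i)).
have := measurable_funB (mi _ mf) (mi _ mg).
move=> /(_ measurableT [set 0%R] (measurable_set1 _)); rewrite setTI.
congr (measurable _); apply/seteqP; split => u /=.
  by move/eqP; rewrite subr_eq0 => /eqP.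
by move=> ->; rewrite subrr.
Qed.

Lemma measurable_pt_set1 (x : pt) : measurable [set x].
Proof.
have := @measurable_pt_eq _ pt id (cst x) (@measurable_id _ _ _) (measurable_cst _).
by congr (measurable _); apply/seteqP.
Qed.

Lemma measurable_config_of k :
  measurable_fun setT (@config_of R d k).
Proof.
apply: measurable_config_fun => B n mB.
elim: k n => [|k IH] n.
  case: (pselect (#|` restr B [fset z in [::]]%fset| = n)) => [e|ne].
    rewrite (_ : [set u | _] = setT)//; apply/seteqP; split => //= u _.
    by rewrite tuple0.
  rewrite (_ : [set u | _] = set0)//; apply/seteqP; split => //= u.
  by rewrite tuple0.
(* The head raises the count only if it lies in [B] and does not recur in the tail, because a point
   set drops repetitions. *)
pose E := [set x : k.+1.-tuple pt | B (thead x)] `&`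
  \bigcap_(i in [set: 'I_k]) ~` [set x : k.+1.-tuple pt | tnth x (lift ord0 i) = thead x].
have mE : measurable E.
  apply: measurableI.
    rewrite -[X in measurable X]setTI; exact: (measurable_tnth ord0).
  apply: fin_bigcap_measurable => [|i _]; first exact: finite_finset.
  apply: measurableC; apply: measurable_pt_eq; exact: measurable_tnth.
have card (x : k.+1.-tuple pt) : #|` restr B (config_of x)| =
    ((x \in E) + #|` restr B (config_of [tuple of behead x])|)%N.
  case/tupleP: x => z x.
  have -> : config_of [tuple of behead [tuple of z :: x]] = config_of x.
    by rewrite /config_of/=.
  have -> : config_of [tuple of z :: x] = (z |` config_of x)%fset.
    by apply/fsetP => y; rewrite !inE.
  rewrite restrU.
  have -> : ([tuple of z :: x] \in E) = (z \in B) && (z \notin tval x).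
    apply/idP/andP => [/set_mem [Bz Hz]|[zB zx]].
      split; first exact/mem_set.
      apply/negP => /tnthP[i zi]; apply: (Hz i I) => /=.
      by rewrite tnthS theadE.
    apply/mem_set; split; first by move: zB => /set_mem.
    move=> i _ /=; rewrite tnthS theadE => xiz; move/negP: zx; apply.
    by rewrite -xiz mem_tnth.
  have [zB|zB] := boolP (z \in B).
    have -> : restr B [fset z]%fset = [fset z]%fset.
      apply/fsetP => y; rewrite in_restr !inE.
      by have [->|] := eqVneq y z; rewrite ?zB.
    by rewrite cardfsU1 in_restr zB andbT !inE.
  have -> : restr B [fset z]%fset = fset0.
    apply/fsetP => y; rewrite in_restr !inE.
    by have [->|] := eqVneq y z; rewrite ?(negbTE zB).
  by rewrite fset0U.
have mb m : measurable [set x : k.+1.-tuple pt |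
    #|` restr B (config_of [tuple of behead x])| = m].
  by have := @measurable_behead _ pt k measurableT _ (IH m); rewrite setTI.
rewrite (_ : [set u | _] =
  (E `&` [set x : k.+1.-tuple pt | (#|` restr B (config_of [tuple of behead x])|).+1 = n]) `|`
  (~` E `&` [set x : k.+1.-tuple pt | #|` restr B (config_of [tuple of behead x])| = n])).
  apply: measurableU; apply: measurableI => //; last exact: measurableC.
  case: n => [|n].
    by rewrite (_ : [set x | _] = set0)//; apply/seteqP; split.
  have := mb n; congr (measurable _); apply/seteqP; split => x /=; first by move=> ->.
  by case.
apply/seteqP; split => x; rewrite /mkset; move: (card x);
  move: #|` restr B (config_of x)| #|` _| => a b ->.
  case: (boolP (x \in E)) => [/set_mem xE|/negP xE] <-; [left|right] => //.
  by split => // /mem_set.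
by move=> [[/mem_set -> <-]//|[xE <-]]; rewrite memNset.
Qed.

Lemma sum_indic_restr (A : set pt) (eta : {fset pt}) :
  \sum_(x <- eta) \1_A x = (#|` restr A eta|)%:R :> R.
Proof.
rewrite card_fset_sum1 natr_sum /restr.
rewrite [LHS](eq_bigr (fun x => if x \in A then 1 else 0)); last first.
  by move=> x _; rewrite indicE; case: (_ \in _).
by rewrite -big_mkcond/= big_fset_condE.
Qed.

Local Open Scope ereal_scope.

Lemma measurable_cfg_count (A : set pt) : measurable A ->
  measurable_fun setT (fun eta : cfg => ((#|` restr A eta|)%:R)%:E : \bar R).
Proof.
move=> mA _ Y mY; rewrite setTI.
exact: (@measurable_count A [set k | Y (k%:R)%:E]).
Qed.

(** This gives the joint measurability of [tilted] in the configuration and the point. On a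
    rectangle the sum is a count times an indicator; Dynkin's lemma reaches all measurable sets,
    complements being harmless since counts are finite, and series of indicators reach all [f]. *)
Lemma nnmeasurable_config_sum d' (U : measurableType d')
    (f : pt * U -> \bar R) : nnmeasurable f ->
  nnmeasurable (fun q : cfg * U => \sum_(x <- (q.1 : {fset pt})) f (x, q.2)).
Proof.
pose K C (q : cfg * U) : \bar R := \sum_(x <- (q.1 : {fset pt})) (\1_C (x, q.2))%:E.
have indic0 C (p : pt * U) : 0 <= (\1_C p)%:E :> \bar R.
  by rewrite lee_fin indicE; case: (_ \in _).
have K0 C q : 0 <= K C q by apply: sume_ge0.
have KT : K setT = fun q => ((#|` restr setT q.1|)%:R)%:E.
  apply/funext => q; rewrite /K sumEFin; congr EFin.
  by rewrite -sum_indic_restr; apply: eq_bigr => x _; rewrite !indicE !in_setT.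
have mT : measurable_fun setT (K setT).
  rewrite KT; apply: (measurableT_comp (measurable_cfg_count measurableT)).
  exact: measurable_fst.
have mK C : measurable C -> measurable_fun setT (K C).
  rewrite measurable_prod_measurableType => mC.
  apply: (dynkin_induction (measurable_prod_measurableType pt U)
    (P := fun C => measurable_fun setT (K C))) mC => //.
  - move=> _ _ [A1 mA1 [B1 mB1 <-]] [A2 mA2 [B2 mB2 <-]].
    exists (A1 `&` A2); first exact: measurableI.
    by exists (B1 `&` B2); [exact: measurableI|rewrite setXI].
  - move=> _ [A mA [B mB <-]].
    rewrite (_ : K _ = fun q => ((#|` restr A q.1|)%:R)%:E * (\1_B q.2)%:E).
      apply: emeasurable_funM.
        by apply: (measurableT_comp (measurable_cfg_count mA)); exact: measurable_fst.
      exact: (nnmeasurable_comp measurable_snd (nnmeasurable_indic mB)).1.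
    apply/funext => q; rewrite /K sumEFin -EFinM -sum_indic_restr mulr_suml.
    congr EFin; apply: eq_bigr => x _; rewrite !indicE in_setX.
    by case: (x \in A); rewrite ?mul1r ?mul0r.
  - move=> C' _ mKC.
    rewrite (_ : K _ = fun q => K setT q - K C' q); first exact: emeasurable_funB.
    apply/funext => q; rewrite /K !sumEFin -EFinB -sumrB; congr EFin.
    apply: eq_bigr => x _; rewrite !indicE in_setC in_setT.
    by case: (_ \in C'); rewrite ?subrr ?subr0.
  - move=> F mF tF mKF.
    rewrite (_ : K _ = fun q => \sum_(0 <= k <oo) K (F k) q).
      by apply: (nnmeasurable_series _).1 => k; split.
    apply/funext => q; rewrite /K nneseries_sum//.
    by apply: eq_bigr => x _; rewrite indic_bigcup.
move=> /nnmeasurable_indic_series[c [A [c0 mA ->]]].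
rewrite (_ : (fun q => _) = fun q => \sum_(0 <= k <oo) (c k)%:E * K (A k) q).
  apply: nnmeasurable_series => k; apply: nnmeasurableM.
    by apply: nnmeasurable_cst; rewrite lee_fin.
  by split => //; exact: mK.
apply/funext => q; rewrite -nneseries_sum; last first.
  by move=> x k _; rewrite mule_ge0// lee_fin.
apply: eq_eseriesr => k _; rewrite /K ge0_sume_distrr//.
Qed.

End config_measurability.

(** * Null points and finite volume for Lebesgue measure on [rpoint] *)

Section lebesgue_point.
Context {R : realType} {d : nat}.

(** For [d = 0] the product measure is a Dirac mass, so positive dimension is essential here. *)
Lemma lebesgue_point_set1 (x : rpoint R d) : (0 < d)%N ->
  lebesgue_point R d [set x] = 0%E.
Proof.
case: d x => // n x _; rewrite /lebesgue_point/=.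
have -> : cons_measure (@lebesgue_measure R)
    (tuple_measure (@lebesgue_measure R) n) [set x] = (@lebesgue_measure R \x
    tuple_measure (@lebesgue_measure R) n)%E ([set thead x] `*` [set [tuple of behead x]]).
  rewrite /cons_measure/= /cons_measure0 /pushforward; congr ((_ \x _)%E _).
  apply/seteqP; split => -[y u] /=.
    by move=> <-; rewrite theadE; split => //=; exact: val_inj.
  by move=> [/= -> ->]; rewrite [RHS]tuple_eta; exact: val_inj.
rewrite product_measure1E//; last exact: measurable_pt_set1.
by rewrite [X in (X * _)%E]lebesgue_measure_set1 mul0e.
Qed.

Lemma measurable_orthotope n (a b : 'I_n -> R) :
  measurable [set x : rpoint R n | forall i, a i <= (tnth x i : R) < b i].
Proof.
rewrite (_ : [set x | _] = \bigcap_(i in [set: 'I_n])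
    ((fun x : rpoint R n => tnth x i : measurableTypeR R) @^-1` `[a i, b i[%classic)); last first.
  apply/seteqP; split => [x H i _|x H i] /=; first by rewrite in_itv/=; exact: H.
  by have := H i I; rewrite /= in_itv.
apply: fin_bigcap_measurable => [|i _]; first exact: finite_finset.
rewrite -[X in measurable X]setTI.
exact: (measurable_tnth i).
Qed.

Lemma lebesgue_point_domain_fin (L : R) : (lebesgue_point R d (domain d L) < +oo)%E.
Proof.
rewrite /lebesgue_point; elim: d => [|n IH] /=.
  by rewrite diracE ltry.
have md := measurable_orthotope (fun=> 0) (fun _ : 'I_n => L).
have -> : cons_measure (@lebesgue_measure R) (tuple_measure (@lebesgue_measure R) n)
    (domain n.+1 L) = (@lebesgue_measure R \x
    tuple_measure (@lebesgue_measure R) n)%E (`[0%R, L[%classic `*` domain n L).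
  rewrite /cons_measure/= /cons_measure0 /pushforward; congr ((_ \x _)%E _).
  apply/seteqP; split => -[y u] /=.
    move=> H; split => /=; first by have := H ord0; rewrite in_itv.
    by move=> i; have := H (lift ord0 i); rewrite tnthS.
  move=> [/= Hy Hu] i; case: (unliftP ord0 i) => [j ->|->].
    by rewrite tnthS; exact: Hu.
  by move: Hy; rewrite in_itv.
rewrite product_measure1E// lte_mul_pinfty//.
  rewrite ge0_fin_numE// [X in (X < _)%E]lebesgue_measure_itv/=.
  by case: ifP => _; rewrite ltry.
Qed.

End lebesgue_point.

(** * Boxes and regions *)

Section geometry.
Context {R : realType} {d : nat}.
Variables (L r : R).
Hypothesis r_gt0 : 0 < r.
Local Notation vtx := (vertex d L r).
Implicit Types (v w : vtx) (A B C : {set vtx}) (x y : rpoint R d).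

Lemma box_inj v w x : box v x -> box w x -> v = w.
Proof.
move=> [_ /= hv] [_ /= hw]; apply/ffunP => i; apply: val_inj => /=.
have le (a b : vtx) : (forall i, (a i)%:R * r <= (tnth x i : R) < (a i).+1%:R * r) ->
    (forall i, (b i)%:R * r <= (tnth x i : R) < (b i).+1%:R * r) -> (a i <= b i)%N.
  move=> /(_ i)/andP[la _] /(_ i)/andP[_ ub].
  by rewrite -ltnS -(ltr_nat R) -(ltr_pM2r r_gt0) (le_lt_trans la).
by apply/eqP; rewrite eqn_leq !le.
Qed.

Lemma measurable_box v : measurable (box v).
Proof. by apply: measurableI; exact: measurable_orthotope. Qed.

Lemma measurable_region A : measurable (region A).
Proof.
rewrite (_ : region A = \bigcup_(v in [set` A]) box v).
  by apply: fin_bigcup_measurable => // v _; exact: measurable_box.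
by apply/seteqP; split => x [v vA bx]; exists v.
Qed.

Lemma regionI A B : region A `&` region B = region (A :&: B)%SET.
Proof.
apply/seteqP; split => x.
  move=> [[v vA bv] [w wB bw]]; exists v => //.
  by rewrite inE vA (box_inj bv bw).
by move=> [v /setIP[vA vB] bv]; split; exists v.
Qed.

Lemma regionU A B : region A `|` region B = region (A :|: B)%SET.
Proof.
apply/seteqP; split => x.
  by move=> [[v vA bv]|[v vB bv]]; exists v => //; rewrite inE ?vA ?vB ?orbT.
by move=> [v /setUP[vA|vB] bv]; [left|right]; exists v.
Qed.

Lemma region0 : region (finset.set0 : {set vtx}) = set0.
Proof. by apply/seteqP; split => x // [v]; rewrite inE. Qed.

Lemma region_domain A : region A `<=` domain d L.
Proof. by move=> x [v _ []]. Qed.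

Lemma regionT : region [set: vtx]%SET = domain d L.
Proof.
apply/seteqP; split; first exact: region_domain.
move=> x dx.
(* The index of the box containing [x] is the integer part of [x_i / r]; it is below the ceiling of
   [L / r] because [x_i < L]. *)
have lt i : (Num.trunc ((tnth x i : R) / r) < nboxes L r)%N.
  have /andP[x0 xL] := dx i.
  have L0 : 0 < L / r by rewrite divr_gt0// (le_lt_trans x0).
  rewrite -(ltr_nat R) (@le_lt_trans _ _ ((tnth x i : R) / r))//.
    by rewrite truncn_le// divr_ge0// ltW.
  rewrite (@lt_le_trans _ _ (L / r))//; first by rewrite ltr_pM2r// invr_gt0.
  rewrite /nboxes; apply: (le_trans (ceil_ge _)).
  rewrite pmulrn abszE ler_int; exact: ler_norm.
exists [ffun i => Ordinal (lt i)] => //; split => // i; rewrite ffunE /=.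
have /andP[x0 _] := dx i.
rewrite -ler_pdivlMr// -ltr_pdivrMr//; apply: truncn_itv.
by rewrite divr_ge0// ltW.
Qed.

(** Some coordinate has box indices at least two apart, so a whole side [r] lies in between. The
    boxes being half-open, the inequality is strict, as needed for the potential to vanish. *)
Lemma far_boxes v w x y : w \notin vball v 1 -> box v x -> box w y ->
  r < eucl_dist x y.
Proof.
rewrite inE negb_forall => /existsP[i wi] [_ /(_ i) /andP[vx xv]] [_ /(_ i) /andP[wy yw]].
have key : r < `|(tnth x i : R) - (tnth y i : R)|.
  have H (a b : nat) (s t : R) : (b + 1 < a)%N -> a%:R * r <= s -> t < b.+1%:R * r ->
      r < s - t.
    move=> ab sa tb; rewrite ltrBrDr (lt_le_trans _ sa)//.
    apply: (@lt_le_trans _ _ (r + b.+1%:R * r)); first by rewrite ltrD2l.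
    rewrite -{1}[r]mul1r -mulrDl; apply: ler_wpM2r; first exact: ltW.
    by rewrite nat1r ler_nat -[b.+1]addn1.
  move: wi; rewrite negb_and -!ltnNge => /orP[vw|wv].
    by apply: lt_le_trans (ler_norm _); exact: H vw vx yw.
  by rewrite distrC; apply: lt_le_trans (ler_norm _); exact: H wv wy xv.
apply: (lt_le_trans key); rewrite -sqrtr_sqr /eucl_dist ler_sqrt; last first.
  by rewrite sumr_ge0// => j _; rewrite sqr_ge0.
by rewrite (bigD1 i)//= lerDl sumr_ge0// => j _; rewrite sqr_ge0.
Qed.

Definition rs A (eta : {fset rpoint R d}) : {fset rpoint R d} := restr (region A) eta.

Lemma rsI A B eta : rs A (rs B eta) = rs (A :&: B)%SET eta.
Proof. by rewrite /rs restrI regionI. Qed.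

Lemma rsU A eta xi : rs A (eta `|` xi)%fset = (rs A eta `|` rs A xi)%fset.
Proof. exact: restrU. Qed.

Lemma rs0 eta : rs finset.set0 eta = fset0.
Proof. by apply/fsetP => x; rewrite in_restr region0 in_set0 andbF. Qed.

Lemma rs_id A eta : configs_in (region A) eta -> rs A eta = eta.
Proof.
move=> h; apply/fsetP => x; rewrite in_restr.
by apply: andb_idr => xe; exact/mem_set/h.
Qed.

Lemma rs_in A eta : configs_in (region A) (rs A eta).
Proof. by move=> x; rewrite in_restr => /andP[_ /set_mem]. Qed.

Lemma rs_domain A eta : configs_in (domain d L) (rs A eta).
Proof. by move=> x /rs_in; exact: region_domain. Qed.

Lemma measurable_rs A : measurable_fun setT (rs A : config R d -> config R d).
Proof. by apply: (@measurable_restr R d (region A)); exact: measurable_region. Qed.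

End geometry.

(** * Energy of a sequence of points *)

Section seq_energy.
Context {R : realType} {d : nat}.
Variable phi : rpoint R d -> rpoint R d -> \bar R.
Local Notation pt := (rpoint R d).
Local Notation cfg := (config R d).
Local Open Scope ereal_scope.
Implicit Types (s t : seq pt) (f : pt -> \bar R).

Fixpoint seq_energy s : \bar R :=
  if s is x :: s' then \sum_(y <- s') phi x y + seq_energy s' else 0.

Definition boltzmann s : \bar R := expeR (- seq_energy s).

Definition seq_config s : cfg := [fset z in s]%fset.

Lemma energy_seq k (x : k.-tuple pt) : energy phi x = seq_energy x.
Proof.
elim: k x => [|k IH] x; first by rewrite /energy big_ord0 tuple0.
case/tupleP: x => z x /=; rewrite /energy big_ord_recl; congr (_ + _).
  rewrite big_mkcond big_ord_recl/= add0e big_tuple; apply: eq_bigr => j _.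
  by rewrite tnth0 tnthS.
rewrite -IH /energy; apply: eq_bigr => i _.
rewrite big_mkcond big_ord_recl/= add0e [RHS]big_mkcond; apply: eq_bigr => j _.
by rewrite /bump/= !add1n ltnS !tnthS.
Qed.

Lemma weight_seq f k (x : k.-tuple pt) :
  weight phi f x = (\prod_(z <- x) f z) * boltzmann x.
Proof. by rewrite /weight energy_seq big_tuple. Qed.

Hypothesis mphi : measurable_fun [set: pt * pt] (fun p => phi p.1 p.2).
Hypothesis phiC : forall x y, phi x y = phi y x.
Hypothesis phi0 : forall x y, 0 <= phi x y.

Lemma seq_energy_ge0 s : 0 <= seq_energy s.
Proof. by elim: s => //= x s IH; rewrite adde_ge0// sume_ge0. Qed.

Lemma seq_energy_cat s t : seq_energy (s ++ t) =
  seq_energy s + seq_energy t + \sum_(x <- s) \sum_(y <- t) phi x y.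
Proof.
elim: s => [|x s IH] /=; first by rewrite big_nil add0e adde0.
by rewrite IH big_cat big_cons/= addeACA -!addeA.
Qed.

Lemma seq_energy_perm s t : perm_eq s t -> seq_energy s = seq_energy t.
Proof.
elim: s t => [|x s IH] t; first by rewrite perm_sym => /perm_nilP ->.
move=> st; have xt : x \in t by rewrite -(perm_mem st) mem_head.
case/splitPr: xt st => t1 t2.
rewrite -[x :: t2]cat1s perm_sym perm_catCA/= perm_cons perm_sym => st.
rewrite /= (IH _ st) (perm_big _ st) big_cat/= !seq_energy_cat/=.
rewrite [X in _ = _ + X](eq_bigr (fun z => phi x z + \sum_(y <- t2) phi z y)); last first.
  by move=> z _; rewrite big_cons phiC.
rewrite big_split/=.
set a := \sum_(y <- t1) phi x y; set b := \sum_(y <- t2) phi x y.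
by rewrite [LHS](AC (2*(2*1)) ((3*(2*4))*(1*5))).
Qed.

Lemma boltzmann_perm s t : perm_eq s t -> boltzmann s = boltzmann t.
Proof. by rewrite /boltzmann => /seq_energy_perm ->. Qed.

Lemma boltzmann_ge0 s : 0 <= boltzmann s.
Proof. exact: expeR_ge0. Qed.

Lemma boltzmann_le1 s : boltzmann s <= 1.
Proof.
rewrite /boltzmann -expeR0 lee_expeR leeNl oppe0; exact: seq_energy_ge0.
Qed.

Lemma expeN_sum (I : Type) (r : seq I) (F : I -> \bar R) :
  (forall i, 0 <= F i) ->
  expeR (- \sum_(i <- r) F i) = \prod_(i <- r) expeR (- F i).
Proof.
move=> F0; elim: r => [|i r IH]; first by rewrite !big_nil oppe0 expeR0.
rewrite !big_cons oppeD ?expeRD ?IH// ge0_adde_def// inE ?F0//.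
exact: sume_ge0.
Qed.

(** The interaction between [s] and [t] factors over the points of [t], and its factors are those by
    which a boundary condition [s] tilts the activity. *)
Lemma boltzmann_cat s t : boltzmann (s ++ t) = boltzmann s * (boltzmann t *
  \prod_(y <- t) expeR (- \sum_(x <- s) phi x y)).
Proof.
have S0 (u w : seq pt) : 0 <= \sum_(x <- u) \sum_(y <- w) phi x y.
  by apply: sume_ge0 => ? _; apply: sume_ge0.
rewrite /boltzmann seq_energy_cat.
have e0 := seq_energy_ge0.
rewrite oppeD; last by rewrite ge0_adde_def// inE ?adde_ge0.
rewrite oppeD; last by rewrite ge0_adde_def// inE.
rewrite !expeRD -muleA; congr (_ * (_ * _)).
rewrite exchange_big/= expeN_sum// => y; exact: sume_ge0.
Qed.

Lemma nnmeasurable_energy : seq_nnmeasurable seq_energy.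
Proof.
move=> k; under eq_fun do rewrite -energy_seq.
apply: nnmeasurable_sum => i; apply: nnmeasurable_sum => j.
split; last by move=> x; exact: phi0.
have m : measurable_fun setT (fun x : k.-tuple pt => (tnth x i, tnth x j)).
  by apply: measurable_fun_pair; exact: measurable_tnth.
exact: (measurableT_comp mphi m).
Qed.

Lemma seq_nnmeasurable_boltzmann : seq_nnmeasurable boltzmann.
Proof. by move=> k; apply: nnmeasurable_expeN; exact: nnmeasurable_energy. Qed.

Lemma seq_nnmeasurable_config (g : cfg -> \bar R) : nnmeasurable g ->
  seq_nnmeasurable (fun s => boltzmann s * g (seq_config s)).
Proof.
move=> ng k; apply: nnmeasurableM; first exact: seq_nnmeasurable_boltzmann.
exact: (nnmeasurable_comp (@measurable_config_of R d k) ng).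
Qed.

Lemma seq_config_perm s t : perm_eq s t -> seq_config s = seq_config t.
Proof.
by move=> st; apply/fsetP => x; rewrite !inE (perm_mem st).
Qed.

Lemma seq_config_cat s t : seq_config (s ++ t) = (seq_config s `|` seq_config t)%fset.
Proof. by apply/fsetP => x; rewrite !(inE, mem_cat). Qed.

Lemma in_seq_config s x : (x \in (seq_config s : {fset pt})) = (x \in s).
Proof. by rewrite inE. Qed.

Lemma sum_seq_config (F : pt -> \bar R) s : uniq s ->
  \sum_(x <- (seq_config s : {fset pt})) F x = \sum_(x <- s) F x.
Proof.
move=> us; apply: perm_big; apply: uniq_perm => // x.
exact: in_seq_config.
Qed.

End seq_energy.

(** * Unnormalised Gibbs kernels *)

Section gibbs_kernel.
Context {R : realType} {d : nat}.
Variables (L r lam : R) (phi : rpoint R d -> rpoint R d -> \bar R).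
Hypothesis d_gt0 : (0 < d)%N.
Hypothesis r_gt0 : 0 < r.
Hypothesis lam_gt0 : 0 < lam.
Hypothesis phi_rep : repulsive_potential r phi.
Local Notation vtx := (vertex d L r).
Local Notation pt := (rpoint R d).
Local Notation cfg := (config R d).
Local Notation leb := (lebesgue_point R d).
Local Notation tl := (tilted phi lam).
Local Open Scope ereal_scope.
Implicit Types (A B C E : {set vtx}) (eta zeta xi : {fset pt}) (g h : cfg -> \bar R).

Let mphi : measurable_fun [set: pt * pt] (fun p => phi p.1 p.2).
Proof. by case: phi_rep. Qed.
Let phiC x y : phi x y = phi y x. Proof. by case: phi_rep. Qed.
Let phi0 x y : 0 <= phi x y. Proof. by case: phi_rep. Qed.
Let phir x y : (r < eucl_dist x y)%R -> phi x y = 0.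
Proof. by case: phi_rep => _ _ _; apply. Qed.

Let sumphi0 (I : Type) (t : seq I) (P : pred I) (F : I -> pt) y :
  0 <= \sum_(i <- t | P i) phi (F i) y.
Proof. exact: sume_ge0. Qed.

Lemma tilted_le eta y : tl eta y <= lam%:E.
Proof.
rewrite /tilted -[leRHS]mule1; apply: lee_wpmul2l; first by rewrite lee_fin ltW.
by rewrite -expeR0 lee_expeR leeNl oppe0.
Qed.

Lemma nnmeasurable_tilted A :
  nnmeasurable (fun q : cfg * pt => tl (rs A q.1) q.2).
Proof.
apply: nnmeasurableM; first by apply: nnmeasurable_cst; rewrite lee_fin ltW.
apply: nnmeasurable_expeN.
have m : measurable_fun setT (fun q : cfg * pt => (rs A q.1 : cfg, q.2)).
  apply: measurable_fun_pair; last exact: measurable_snd.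
  exact: (measurableT_comp (measurable_rs A) measurable_fst).
have nphi : nnmeasurable (fun p : pt * pt => phi p.1 p.2) by split.
exact: (nnmeasurable_comp m (nnmeasurable_config_sum nphi)).
Qed.

Lemma nnmeasurable_tilted_fixed eta : nnmeasurable (tl eta).
Proof.
apply: nnmeasurableM; first by apply: nnmeasurable_cst; rewrite lee_fin ltW.
apply: nnmeasurable_expeN; apply: nnmeasurable_sum => x; split => //.
have m : measurable_fun setT (fun y : pt => (x, y)).
  by apply: measurable_fun_pair; [exact: measurable_cst|exact: measurable_id].
exact: (measurableT_comp mphi m).
Qed.

(** The indicator of the region is moved into the activity, so that integrals over tuples range over
    the whole space and become instances of [itint]. *)
Definition activity C eta : pt -> \bar R := restr_activity (tl eta) (region C).

Lemma nnmeasurable_activity C eta : nnmeasurable (activity C eta).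
Proof.
apply: nnmeasurableM; first exact: nnmeasurable_tilted_fixed.
exact: (nnmeasurable_indic (measurable_region C)).
Qed.

Lemma activity_supp C eta y : activity C eta y != 0 -> region C y.
Proof.
move=> ay; apply: contrapT => nCy; move: ay.
by rewrite /activity /restr_activity indicE memNset// mule0 eqxx.
Qed.

Lemma activityE C eta y : region C y -> activity C eta y = tl eta y.
Proof. by move=> Cy; rewrite /activity /restr_activity indicE mem_set// mule1. Qed.

(** Left unnormalised: its value at the constant 1 is the partition function, so the normalising
    constants stay visible and can be cancelled. *)
Definition gker C eta g : \bar R :=
  \sum_(0 <= k <oo) ((k`!%:R : R)^-1)%:E *
    \int[tuple_measure leb k]_(x in @tuples_in R d (region C) k)
      (weight phi (tl eta) x * g (config_of x)).

Lemma weight_restr (f : pt -> \bar R) (A : set pt) g k :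
  (fun x : k.-tuple pt => weight phi f x * g (config_of x)) \_ (@tuples_in R d A k) =
  (fun x => (\prod_(z <- x) restr_activity f A z) *
            (boltzmann phi x * g (seq_config x))).
Proof.
apply/funext => x; rewrite patchE; case: ifPn => [/set_mem xA|].
  rewrite weight_seq -muleA; congr (_ * _).
  rewrite !big_tuple; apply: eq_bigr => i _.
  by rewrite /restr_activity indicE mem_set ?mule1//; exact: xA.
move=> /negP xA; have [i nAi] : exists i, ~ A (tnth x i).
  by apply/existsNP => H; apply: xA; exact/mem_set.
by rewrite big_tuple (bigD1 i)//= /restr_activity indicE memNset// mule0 !mul0e.
Qed.

Lemma gkerE C eta g : gker C eta g = \sum_(0 <= k <oo) ((k`!%:R : R)^-1)%:E *
    \int[tuple_measure leb k]_x ((\prod_(z <- x) activity C eta z) *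
       (boltzmann phi x * g (seq_config x))).
Proof.
by apply: eq_eseriesr => k _; rewrite integral_mkcond weight_restr.
Qed.

Lemma gker_itint C eta g : nnmeasurable g ->
  gker C eta g = \sum_(0 <= k <oo) ((k`!%:R : R)^-1)%:E *
    itint leb (activity C eta) k (fun s => boltzmann phi s * g (seq_config s)).
Proof.
move=> ng; rewrite gkerE; apply: eq_eseriesr => k _; congr (_ * _).
apply: (tuple_integral leb k (nnmeasurable_activity C eta)
  (F := fun s => boltzmann phi s * g (seq_config s))).
exact: seq_nnmeasurable_config.
Qed.

Lemma gker_ext C eta eta' g g' :
  (forall y, region C y -> tl eta y = tl eta' y) ->
  (forall xi, configs_in (region C) xi -> g xi = g' xi) ->
  gker C eta g = gker C eta' g'.
Proof.
move=> te ge; apply: eq_eseriesr => k _; congr (_ * _).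
apply: eq_integral => x /set_mem xC; congr (_ * _).
  by rewrite /weight; congr (_ * _); apply: eq_bigr => i _; rewrite te//; exact: xC.
by apply: ge => z; rewrite inE => /tnthP[i ->]; exact: xC.
Qed.

Let fact_ge0 k : (0 : \bar R) <= ((k`!%:R : R)^-1)%:E.
Proof. by rewrite lee_fin invr_ge0. Qed.

(** Measurability in the boundary condition, by Tonelli's theorem applied to an integrand that
    depends jointly on the configuration and the tuple. *)
Lemma nnmeasurable_gker A C (f : cfg * cfg -> \bar R) : nnmeasurable f ->
  nnmeasurable (fun zeta : cfg => gker C (rs A zeta) (fun xi => f (zeta, xi))).
Proof.
move=> nf; under eq_fun do rewrite gkerE.
apply: nnmeasurable_series => k; apply: nnmeasurableM.
  exact: nnmeasurable_cst.
pose G (q : cfg * k.-tuple pt) := (\prod_(z <- q.2) activity C (rs A q.1) z) *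
       (boltzmann phi q.2 * f (q.1, seq_config q.2)).
have nG : nnmeasurable G.
  apply: nnmeasurableM; last first.
    apply: nnmeasurableM.
      exact: (nnmeasurable_comp measurable_snd
                (seq_nnmeasurable_boltzmann mphi phi0 k)).
    have m : measurable_fun setT (fun q : cfg * k.-tuple pt => (q.1, config_of q.2)).
      apply: measurable_fun_pair; first exact: measurable_fst.
      exact: (measurableT_comp (@measurable_config_of R d k) measurable_snd).
    exact: (nnmeasurable_comp m nf).
  under eq_fun do rewrite big_tuple.
  apply: nnmeasurable_prod => i; apply: nnmeasurableM.
    have m : measurable_fun setT (fun q : cfg * k.-tuple pt => (q.1, tnth q.2 i)).
      apply: measurable_fun_pair; first exact: measurable_fst.
      exact: (measurableT_comp (measurable_tnth i) measurable_snd).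
    exact: (nnmeasurable_comp m (nnmeasurable_tilted A)).
  have m : measurable_fun setT (fun q : cfg * k.-tuple pt => tnth q.2 i).
    exact: (measurableT_comp (measurable_tnth i) measurable_snd).
  exact: (nnmeasurable_comp m (nnmeasurable_indic (measurable_region C))).
split; last by move=> zeta; apply: integral_ge0 => x _; exact: (nG.2 (zeta, x)).
exact: (measurable_fun_fubini_tonelli_F G nG.1 nG.2).
Qed.

Lemma sigma_functional_gker C eta : sigma_functional (gker C eta).
Proof.
have nP := seq_nnmeasurable_prod (nnmeasurable_activity C eta).
have nI k g : nnmeasurable g -> nnmeasurable (fun x : k.-tuple pt =>
    (\prod_(z <- x) activity C eta z) * (boltzmann phi x * g (seq_config x))).
  by move=> ng; apply: nnmeasurableM => //; exact: seq_nnmeasurable_config.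
split.
- move=> g ng; rewrite gkerE; apply: nneseries_ge0 => k _ _.
  by rewrite mule_ge0//; apply: integral_ge0 => x _; exact: (nI k g ng).2.
- move=> g ng; rewrite gkerE.
  transitivity (\sum_(0 <= k <oo) \sum_(0 <= j <oo) ((k`!%:R : R)^-1)%:E *
    \int[tuple_measure leb k]_x ((\prod_(z <- x) activity C eta z) *
       (boltzmann phi x * g j (seq_config x)))).
    apply: eq_eseriesr => k _; rewrite nneseriesZl; last first.
      by move=> j _; apply: integral_ge0 => x _; exact: (nI k _ (ng j)).2.
    congr (_ * _); rewrite -integral_nneseries//; last 2 first.
    + by move=> j; exact: (nI k _ (ng j)).1.
    + by move=> j x _; exact: (nI k _ (ng j)).2.
    apply: eq_integral => x _; rewrite -nneseriesZl_ereal; last 2 first.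
    + exact: boltzmann_ge0.
    + by move=> j; exact: (ng j).2.
    rewrite -nneseriesZl_ereal//; first exact: (nP k).2.
    by move=> j; rewrite mule_ge0 ?boltzmann_ge0//; exact: (ng j).2.
  rewrite nneseries_interchange; last first.
    move=> k j; rewrite mule_ge0//; apply: integral_ge0 => x _.
    exact: (nI k _ (ng j)).2.
  by apply: eq_eseriesr => j _; rewrite gkerE.
- move=> c g c0 ng; rewrite !gkerE -nneseriesZl; last first.
    move=> k _; rewrite mule_ge0//; apply: integral_ge0 => x _.
    exact: (nI k _ ng).2.
  apply: eq_eseriesr => k _; rewrite muleCA; congr (_ * _).
  rewrite -ge0_integralZl//; last 2 first.
  + exact: (nI k _ ng).1.
  + by move=> x _; exact: (nI k _ ng).2.
  by apply: eq_integral => x _; rewrite 2!(muleCA _ c%:E).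
Qed.

Lemma partition_fun_gker C eta :
  partition_fun phi (tl eta) (region C) = gker C eta (fun=> 1).
Proof.
apply: eq_eseriesr => k _; congr (_ * _); apply: eq_integral => x _.
by rewrite mule1.
Qed.

(** The empty configuration alone contributes 1, so partition functions can be divided by. *)
Lemma gker1_ge1 C eta : 1 <= gker C eta (fun=> 1).
Proof.
have n1 : nnmeasurable (fun _ : cfg => 1 : \bar R) by exact: nnmeasurable_cst.
rewrite gker_itint//; apply: le_trans (nneseries_lim_ge 1 _); last first.
  move=> k _ _; rewrite mule_ge0// itint_ge0//; first exact: (nnmeasurable_activity _ _).2.
  by move=> s; rewrite mule1 boltzmann_ge0.
by rewrite big_nat1/= fact0 invr1 mul1e mule1 /boltzmann/= oppr0 expR0.
Qed.

Lemma itint_le_pow (p : pt -> \bar R) (M : R) k (F : seq pt -> \bar R) :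
  nnmeasurable p -> (0 <= M)%R -> \int[leb]_z p z <= M%:E ->
  seq_nnmeasurable F -> (forall s, F s <= 1) -> itint leb p k F <= (M ^+ k)%:E.
Proof.
move=> np M0 pM; elim: k F => [|k IH] F nF F1 /=; first by rewrite expr0.
apply: (@le_trans _ _ (\int[leb]_z ((M ^+ k)%:E * p z))).
  have nI := nnmeasurableM np (nnmeasurable_itint_cons leb k np nF).
  apply: ge0_le_integral => //.
  - by move=> z _; exact: nI.2.
  - exact: nI.1.
  - by apply: emeasurable_funM; [exact: measurable_cst|exact: np.1].
  move=> z _; rewrite muleC lee_wpmul2r//; first exact: np.2.
  by apply: IH => //; exact: seq_nnmeasurable_cons.
rewrite ge0_integralZl//; last 3 first.
- exact: np.1.
- by move=> z _; exact: np.2.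
- by rewrite lee_fin exprn_ge0.
by rewrite exprSr EFinM lee_wpmul2l// lee_fin exprn_ge0.
Qed.

(** Repulsion bounds the Boltzmann factor by 1 and the activity by [lam]; the exponential series at
    [lam] times the volume of the domain dominates. *)
Lemma gker1_fin C eta : gker C eta (fun=> 1) < +oo.
Proof.
have n1 : nnmeasurable (fun _ : cfg => 1 : \bar R) by exact: nnmeasurable_cst.
have na := nnmeasurable_activity C eta.
have vfin : leb (domain d L) \is a fin_num.
  by rewrite ge0_fin_numE// lebesgue_point_domain_fin.
pose M := (lam * fine (leb (domain d L)))%R.
have M0 : (0 <= M)%R by rewrite mulr_ge0 ?fine_ge0// ltW.
have md : measurable (domain d L : set pt).
  by rewrite -(regionT L r_gt0); exact: measurable_region.
have aM : \int[leb]_z activity C eta z <= M%:E.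
  apply: (@le_trans _ _ (\int[leb]_z (lam%:E * (\1_(domain d L : set pt) z)%:E))).
    apply: ge0_le_integral => //.
    - by move=> z _; exact: na.2.
    - exact: na.1.
    - apply: emeasurable_funM; first exact: measurable_cst.
      exact: (nnmeasurable_indic md).1.
    move=> z _; have [Cz|Cz] := pselect (region C z).
      rewrite activityE// indicE mem_set ?mule1 ?tilted_le//.
      exact: region_domain Cz.
    have -> : activity C eta z = 0.
      by apply/eqP; apply: contra_notT Cz => /activity_supp.
    by rewrite mule_ge0// lee_fin// ltW.
  rewrite ge0_integralZl//; last 2 first.
  - exact: (nnmeasurable_indic md).1.
  - by rewrite lee_fin ltW.
  by rewrite integral_indic// setIT /M EFinM fineK.
rewrite gker_itint//.
apply: (@le_lt_trans _ _ (\sum_(0 <= k <oo) (exp_coeff M k)%:E)).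
  apply: lee_nneseries => [k _ _|k _].
    rewrite mule_ge0// itint_ge0//; first exact: na.2.
    by move=> s; rewrite mule1 boltzmann_ge0.
  rewrite /exp_coeff/= mulrC EFinM lee_wpmul2l//.
  apply: itint_le_pow => //; first exact: (seq_nnmeasurable_config mphi phi0 n1).
  by move=> s; rewrite mule1; exact: boltzmann_le1.
rewrite (_ : (fun n => _) = EFin \o series (exp_coeff M)); last first.
  by apply/funext => n; rewrite /= /series/= sumEFin.
by rewrite EFin_lim ?ltry//; exact: is_cvg_series_exp_coeff.
Qed.

(** The finite range in terms of boxes: only the part of a boundary condition in boxes adjacent to
    [C] is felt in [C]. *)
Lemma tilted_far A B C zeta y : (A \subset B)%SET ->
  (forall v w, v \in (B :\: A)%SET -> w \in C -> w \notin vball v 1) ->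
  region C y -> tl (rs B zeta) y = tl (rs A zeta) y.
Proof.
move=> AB far [w wC bw]; rewrite /tilted; congr (_ * expeR (- _)).
apply/esym; apply: big_fset_incl.
  apply/fsubsetP => x; rewrite !in_restr => /andP[-> /set_mem [v vA bv]] /=.
  by apply/mem_set; exists v => //; exact: (fintype.subsetP AB).
move=> x; rewrite !in_restr => /andP[xz /set_mem [v vB bv]].
rewrite xz/= => /negP nA; apply: phir.
apply: (far_boxes r_gt0 _ bv bw); apply: far => //.
rewrite inE vB andbT; apply/negP => vA; apply: nA; apply/mem_set.
by exists v.
Qed.

(** Repetition-free and disjoint from [eta], because the union of point sets would count a repeated
    or common point once. *)
Lemma tilted_seq_config eta s y : uniq s -> (forall x, x \in s -> x \notin eta) ->
  tl (eta `|` seq_config s)%fset y = tl eta y * expeR (- \sum_(x <- s) phi x y).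
Proof.
move=> us dis; rewrite /tilted -muleA; congr (_ * _).
rewrite -expeRD -oppeD; last by rewrite ge0_adde_def// inE.
congr (expeR (- _)); rewrite -(sum_seq_config (phi ^~ y) us).
rewrite -big_cat/=; apply: perm_big; apply: uniq_perm => //; first exact: fset_uniq.
  rewrite cat_uniq !fset_uniq/= andbT.
  by apply/hasPn => x; rewrite in_seq_config; exact: dis.
by move=> x; rewrite mem_cat inE.
Qed.

End gibbs_kernel.

(** * Consistency of the Gibbs kernels *)

Section specification.
Context {R : realType} {d : nat}.
Variables (L r lam : R) (phi : rpoint R d -> rpoint R d -> \bar R).
Hypothesis d_gt0 : (0 < d)%N.
Hypothesis r_gt0 : 0 < r.
Hypothesis lam_gt0 : 0 < lam.
Hypothesis phi_rep : repulsive_potential r phi.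
Local Notation vtx := (vertex d L r).
Local Notation pt := (rpoint R d).
Local Notation cfg := (config R d).
Local Notation leb := (lebesgue_point R d).
Local Notation tl := (tilted phi lam).
Local Notation K := (gker lam phi).
Local Open Scope ereal_scope.
Implicit Types (A B C E : {set vtx}) (eta zeta xi : {fset pt}) (g h : cfg -> \bar R).

Let mphi : measurable_fun [set: pt * pt] (fun p => phi p.1 p.2).
Proof. by case: phi_rep. Qed.
Let phiC x y : phi x y = phi y x. Proof. by case: phi_rep. Qed.
Let phi0 x y : 0 <= phi x y. Proof. by case: phi_rep. Qed.

(* the unnormalised finite-volume Gibbs kernel on [region C], with the part of
   [zeta] outside [region C] as boundary condition *)
Definition gspec C zeta h : \bar R :=
  K C (rs (~: C)%SET zeta) (fun xi => h (rs (~: C)%SET zeta `|` rs C xi)%fset).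

Lemma measurable_glue A B : (A :&: B)%SET = finset.set0 ->
  measurable_fun setT (fun p : cfg * cfg => (rs A p.1 `|` rs B p.2)%fset : cfg).
Proof.
move=> AB; apply: measurable_restrU; try exact: measurable_region.
by rewrite regionI// AB region0.
Qed.

Lemma measurable_glue_fixed A B zeta : (A :&: B)%SET = finset.set0 ->
  measurable_fun setT (fun xi : cfg => (rs A zeta `|` rs B xi)%fset : cfg).
Proof.
move=> AB; have m : measurable_fun setT (fun xi : cfg => (zeta : cfg, xi)).
  by apply: measurable_fun_pair; [exact: measurable_cst|exact: measurable_id].
exact: (measurableT_comp (measurable_glue AB) m).
Qed.

Lemma nnmeasurable_glue A B zeta h : (A :&: B)%SET = finset.set0 ->
  nnmeasurable h -> nnmeasurable (fun xi : cfg => h (rs A zeta `|` rs B xi)%fset).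
Proof.
by move=> AB nh; exact: (nnmeasurable_comp (measurable_glue_fixed zeta AB) nh).
Qed.

Let CC C : (~: C :&: C)%SET = finset.set0.
Proof. by rewrite finset.setIC finset.setICr. Qed.

Lemma nnmeasurable_gspec C h : nnmeasurable h ->
  nnmeasurable (fun zeta : cfg => gspec C zeta h).
Proof.
move=> nh; apply: (nnmeasurable_gker lam_gt0 phi_rep (~: C)%SET C
  (f := fun p : cfg * cfg => h (rs (~: C)%SET p.1 `|` rs C p.2)%fset)).
exact: (nnmeasurable_comp (measurable_glue (CC C)) nh).
Qed.

Lemma sigma_functional_gspec C zeta : sigma_functional (gspec C zeta).
Proof.
exact: (sigma_functional_comp (measurable_glue_fixed zeta (CC C))
  (sigma_functional_gker lam_gt0 phi_rep C (rs (~: C)%SET zeta))).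
Qed.

Lemma gspec_rs C zeta zeta' h :
  rs (~: C)%SET zeta = rs (~: C)%SET zeta' -> gspec C zeta h = gspec C zeta' h.
Proof. by rewrite /gspec => ->. Qed.

(** The kernel is proper: a factor fixed by the boundary condition comes out. It must be finite
    since functionals are homogeneous for real factors. *)
Lemma gspecM C zeta (c : \bar R) g h : 0 <= c -> c \is a fin_num -> nnmeasurable h ->
  (forall xi, g (rs (~: C)%SET zeta `|` rs C xi)%fset = c) ->
  gspec C zeta (fun eta => g eta * h eta) = c * gspec C zeta h.
Proof.
move=> c0 cf nh gc; have H := sigma_functional_gspec C zeta.
rewrite -[in RHS](fineK cf) -(sfunZ H (fine_ge0 c0) nh).
by congr (K _ _ _); apply/funext => xi; rewrite gc fineK.
Qed.

Lemma activityU C1 C2 eta : (C1 :&: C2)%SET = finset.set0 ->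
  activity lam phi (C1 :|: C2)%SET eta =
  fun z => activity lam phi C1 eta z + activity lam phi C2 eta z.
Proof.
move=> C12; apply/funext => z; rewrite /activity /restr_activity -ge0_muleDr; last 2 first.
- by rewrite lee_fin.
- by rewrite lee_fin.
congr (_ * _); rewrite -EFinD -regionU !indicE in_setU; congr EFin.
have [z1|] := boolP (z \in region C1); last by rewrite add0r.
have [z2|] := boolP (z \in region C2); last by rewrite addr0.
have : z \in region C1 `&` region C2 by rewrite in_setI z1.
by rewrite regionI// C12 region0 in_set0.
Qed.

Let fact_ge0 k : (0 : \bar R) <= ((k`!%:R : R)^-1)%:E.
Proof. by rewrite lee_fin invr_ge0. Qed.

(* DLR equations *)
Lemma gspec_chain C1 C2 zeta h : nnmeasurable h -> (C1 :&: C2)%SET = finset.set0 ->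
  gspec (C1 :|: C2)%SET zeta h =
  gspec C1 (rs (~: C2)%SET zeta) (fun eta => gspec C2 eta h).
Proof.
move=> nh C12; set eta := rs (~: (C1 :|: C2))%SET zeta.
pose q1 := activity lam phi C1 eta; pose q2 := activity lam phi C2 eta.
have nq C eta' := nnmeasurable_activity lam_gt0 phi_rep C eta'.
pose F s := boltzmann phi s * h (eta `|` rs (C1 :|: C2)%SET (seq_config s))%fset.
have ng : nnmeasurable (fun xi : cfg => h (eta `|` rs (C1 :|: C2)%SET xi)%fset).
  exact: nnmeasurable_glue.
have nF : seq_nnmeasurable F by exact: (seq_nnmeasurable_config mphi phi0 ng).
have sF : seq_symmetric F.
  move=> s s' ss'; rewrite /F (boltzmann_perm phiC ss').
  by rewrite (seq_config_perm ss').
pose D i j := itint leb q1 i (fun s => itint leb q2 j (fun s' => F (s ++ s'))).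
have nD j : seq_nnmeasurable (fun s => itint leb q2 j (fun s' => F (s ++ s'))).
  exact: (seq_nnmeasurable_itint leb j (nq _ _) nF).
have D0 i j : 0 <= D i j.
  by apply: itint_ge0 => [z|s]; [exact: (nq _ _).2|exact: (seq_nnmeasurable_ge0 s (nD j))].
transitivity (\sum_(0 <= i <oo) \sum_(0 <= j <oo)
    ((i`!%:R : R)^-1)%:E * (((j`!%:R : R)^-1)%:E * D i j)).
  rewrite /gspec -/eta (gker_itint lam_gt0 phi_rep)// -nneseries_antidiagonal; last first.
    by move=> i j; rewrite !mule_ge0.
  apply: eq_eseriesr => n _; rewrite activityU//.
  (* Each of the [n] points falls in [C1] or in [C2]. The binomial coefficient turns [1 / n!] into
     [1 / (i! (n - i)!)], and summing over [n] runs through the antidiagonals of a double series. *)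
  rewrite (itint_add leb n (nq C1 eta) (nq C2 eta) nF sF).
  rewrite ge0_sume_distrr; last first.
    by move=> i _; rewrite mule_ge0//; exact: D0.
  apply: eq_bigr => i _; rewrite !muleA -/(D i (n - i)%N); congr (_ * _).
  have le_in : (i <= n)%N by rewrite -ltnS ltn_ord.
  rewrite -!EFinM; congr EFin; rewrite -(bin_fact le_in) !natrM.
  have f0 m : m`!%:R != 0%R :> R by rewrite pnatr_eq0 -lt0n fact_gt0.
  have b0 : 'C(n, i)%:R != 0%R :> R by rewrite pnatr_eq0 -lt0n bin_gt0.
  by field; rewrite b0 !f0.
have etaE : rs (~: C1)%SET (rs (~: C2)%SET zeta) = eta.
  by rewrite rsI// -finset.setCU.
have dis1 : (~: (C1 :|: C2) :&: C1)%SET = finset.set0.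
  by apply/setP => w; rewrite !inE; case: (w \in C1); case: (w \in C2).
have sub2 : (~: C2 :&: ~: (C1 :|: C2))%SET = (~: (C1 :|: C2))%SET.
  by apply/setP => w; rewrite !inE; case: (w \in C1); case: (w \in C2).
have sub1 : (~: C2 :&: C1)%SET = C1.
  apply/setP => w; rewrite !inE; case: (boolP (w \in C1)); rewrite ?andbF//= => w1.
  by rewrite andbT; apply/negP => w2; have : w \in (C1 :&: C2)%SET;
     [rewrite inE w1|rewrite C12 inE].
have ng1 : nnmeasurable (fun xi : cfg => gspec C2 (eta `|` rs C1 xi)%fset h).
  exact: (nnmeasurable_glue zeta dis1 (nnmeasurable_gspec C2 nh)).
rewrite [RHS]/gspec etaE (gker_itint lam_gt0 phi_rep)//.
apply: eq_eseriesr => i _; rewrite nneseriesZl; last by move=> j _; rewrite mule_ge0.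
congr (_ * _).
have nZ j : seq_nnmeasurable (fun s =>
    ((j`!%:R : R)^-1)%:E * itint leb q2 j (fun s' => F (s ++ s'))).
  move=> k; apply: nnmeasurableM; last exact: nD.
  by apply: nnmeasurable_cst; exact: fact_ge0.
transitivity (itint leb q1 i (fun s =>
    \sum_(0 <= j <oo) ((j`!%:R : R)^-1)%:E * itint leb q2 j (fun s' => F (s ++ s')))).
  rewrite (itint_series leb i (nq C1 eta) nZ).
  by apply: eq_eseriesr => j _; rewrite (itintZ leb i (nq C1 eta) (fact_ge0 j) (nD j)).
(* A configuration forgets multiplicities, so the two integrands only agree on
   sequences without repetitions; these are almost all, as [0 < d]. *)
have nuni x := @lebesgue_point_set1 R d x d_gt0.
apply: (itint_uniq i (@measurable_pt_set1 R d) nuni (nq C1 eta)).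
- by move=> k; apply: nnmeasurable_series => j; exact: nZ.
- exact: (seq_nnmeasurable_config mphi phi0 ng1).
move=> s us /(_ _ _)/activity_supp-sC1.
have cs : rs C1 (seq_config s) = seq_config s.
  by apply: rs_id => x; rewrite in_seq_config; exact: sC1.
have bE : rs (~: C2)%SET (eta `|` rs C1 (seq_config s))%fset = (eta `|` seq_config s)%fset.
  by rewrite rsU /eta !rsI// sub2 sub1 cs.
set eta' := (eta `|` seq_config s)%fset in bE.
have ng2 : nnmeasurable (fun xi : cfg => h (eta' `|` rs C2 xi)%fset).
  by rewrite -bE; exact: nnmeasurable_glue.
rewrite /gspec bE (gker_itint lam_gt0 phi_rep)//.
have nG := seq_nnmeasurable_config mphi phi0 ng2.
rewrite -nneseriesZl_ereal; last 2 first.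
- exact: boltzmann_ge0.
- move=> j; rewrite mule_ge0// itint_ge0//; first exact: (nq _ _).2.
  by move=> u; exact: (seq_nnmeasurable_ge0 u nG).
apply: eq_eseriesr => j _; rewrite [RHS]muleCA; congr (_ * _).
(* The points [s] placed in [C1] join the boundary condition of the inner kernel and multiply its
   activity by [Es], which matches the cross factor in [boltzmann_cat]. *)
pose Es y := expeR (- \sum_(x <- s) phi x y).
have nEs : nnmeasurable Es.
  apply: nnmeasurable_expeN; apply: nnmeasurable_sum => x; split => //.
  have m : measurable_fun setT (fun y : pt => (x, y)).
    by apply: measurable_fun_pair; [exact: measurable_cst|exact: measurable_id].
  exact: (measurableT_comp mphi m).
have dis x : x \in s -> x \notin eta.
  move=> xs; apply/negP; rewrite in_restr => /andP[_ /set_mem [w]].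
  rewrite !inE negb_or => /andP[w1 _] bw.
  have [w' w'1 bw'] := sC1 _ xs.
  by move: w1; rewrite (box_inj r_gt0 bw bw') w'1.
have -> : activity lam phi C2 eta' = fun z => q2 z * Es z.
  apply/funext => z; rewrite /q2 /activity /restr_activity.
  by rewrite (tilted_seq_config lam phi_rep)// muleAC.
rewrite (itintM leb j (nq C2 eta) nEs nG).
have nEG := seq_nnmeasurable_prod nEs.
have nEG' : seq_nnmeasurable (fun u => (\prod_(z <- u) Es z) *
    (boltzmann phi u * h (eta' `|` rs C2 (seq_config u))%fset)).
  by move=> k; apply: nnmeasurableM.
rewrite -(itintZ leb j (nq C2 eta) (boltzmann_ge0 phi s) nEG').
apply: (itint_uniq j (@measurable_pt_set1 R d) nuni (nq C2 eta)).
- exact: seq_nnmeasurable_catl.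
- by move=> k; apply: nnmeasurableM => //; apply: nnmeasurable_cst; exact: boltzmann_ge0.
move=> u _ /(_ _ _)/activity_supp-uC2.
rewrite /F (boltzmann_cat phi0) -!muleA; congr (_ * _).
rewrite [RHS]muleCA; congr (_ * (_ * h _)).
have cu : rs C2 (seq_config u) = seq_config u.
  by apply: rs_id => x; rewrite in_seq_config; exact: uC2.
rewrite cu seq_config_cat rsU /eta' -fsetUA; congr (_ `|` (_ `|` _))%fset.
  by apply: rs_id => x; rewrite in_seq_config => /sC1; rewrite -regionU; left.
by apply: rs_id => x; rewrite in_seq_config => /uC2; rewrite -regionU; right.
Qed.

End specification.

(** * One update of the algorithm *)

Section update_step.
Context {R : realType} {d : nat}.
Variables (L r lam : R) (phi : rpoint R d -> rpoint R d -> \bar R) (ell : nat).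
Variable kappa : {set vertex d L r} -> vertex d L r -> {fset rpoint R d} -> R.
Hypothesis d_gt0 : (0 < d)%N.
Hypothesis r_gt0 : 0 < r.
Hypothesis lam_gt0 : 0 < lam.
Hypothesis ell_gt0 : (0 < ell)%N.
Hypothesis phi_rep : repulsive_potential r phi.
Hypothesis kappa_bfc : bayes_filter_correction phi lam ell kappa.
Local Notation vtx := (vertex d L r).
Local Notation pt := (rpoint R d).
Local Notation cfg := (config R d).
Local Notation leb := (lebesgue_point R d).
Local Notation tl := (tilted phi lam).
Local Notation K := (gker lam phi).
Local Notation gspec := (gspec lam phi).
Local Open Scope ereal_scope.
Implicit Types (A B C E : {set vtx}) (eta zeta xi : {fset pt}) (g h : cfg -> \bar R).

Let K1_fin C eta : K C eta (fun=> 1) \is a fin_num.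
Proof.
rewrite ge0_fin_numE; first exact: gker1_fin.
exact: le_trans (gker1_ge1 lam_gt0 phi_rep _ _).
Qed.

Let K1_neq0 C eta : K C eta (fun=> 1) != 0.
Proof.
by rewrite gt_eqF// (lt_le_trans _ (gker1_ge1 lam_gt0 phi_rep _ _)).
Qed.

Let K1_gt0 C eta : 0 < K C eta (fun=> 1).
Proof. exact: lt_le_trans (gker1_ge1 lam_gt0 phi_rep _ _). Qed.

Let invK1 C eta :
  (K C eta (fun=> 1))^-1 = ((fine (K C eta (fun=> 1%E)))^-1)%:E.
Proof.
rewrite -[in LHS](fineK (K1_fin C eta)) inver ifF//.
by apply/negbTE; rewrite fine_eq0.
Qed.

Lemma weight_gibbs_restr (f : pt -> \bar R) (A Lam : set pt) (E : set cfg) k :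
  A `<=` Lam ->
  \int[tuple_measure leb k]_(x in @tuples_in R d Lam k `&` @config_of R d k @^-1` E)
    weight phi (restr_activity f A) x =
  \int[tuple_measure leb k]_(x in @tuples_in R d A k)
    (weight phi f x * (\1_E (config_of x))%:E).
Proof.
move=> AL; rewrite integral_mkcond [RHS]integral_mkcond.
rewrite (weight_restr phi f A (fun eta => (\1_E eta)%:E)).
apply: eq_integral => x _; rewrite patchE; case: ifPn.
  by move=> /set_mem [_ xE]; rewrite weight_seq indicE mem_set// mule1.
move=> /negP xA; have [xE|xE] := pselect (E (config_of x)); last first.
  by rewrite indicE memNset// !mule0.
have [i nAi] : exists i, ~ A (tnth x i).
  by apply/existsNP => H; apply: xA; apply/mem_set; split => // i; exact: AL.
by rewrite big_tuple (bigD1 i)//= /restr_activity indicE memNset// mule0 !mul0e.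
Qed.

Lemma gibbs_restr_gker C eta (E : set cfg) (Lam : set pt) :
  region C `<=` Lam ->
  gibbs phi (restr_activity (tl eta) (region C)) Lam E =
  K C eta (fun xi => (\1_E xi)%:E) / K C eta (fun=> 1).
Proof.
move=> CL.
have num F : \sum_(0 <= k <oo) ((k`!%:R : R)^-1)%:E *
    \int[tuple_measure leb k]_(x in @tuples_in R d Lam k `&` @config_of R d k @^-1` F)
      weight phi (restr_activity (tl eta) (region C)) x =
    K C eta (fun xi => (\1_F xi)%:E).
  by apply: eq_eseriesr => k _; rewrite weight_gibbs_restr.
have den : partition_fun phi (restr_activity (tl eta) (region C)) Lam = K C eta (fun=> 1).
  rewrite (_ : (fun=> 1) = fun xi : cfg => (\1_[set: cfg] xi)%:E); last first.
    by apply/funext => xi; rewrite indicE in_setT.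
  by rewrite -num; apply: eq_eseriesr => k _; rewrite preimage_setT setIT.
by rewrite /gibbs num den.
Qed.

Lemma gibbs_domain_gker (E : set cfg) : gibbs phi (cst lam%:E) (domain d L) E =
  K [set: vtx]%SET fset0 (fun xi => (\1_E xi)%:E) / K [set: vtx]%SET fset0 (fun=> 1).
Proof.
have tE : cst lam%:E = tl fset0.
  by apply/funext => y; rewrite /tilted big_seq_fset0 oppe0 expeR0 mule1.
have num : \sum_(0 <= k <oo) ((k`!%:R : R)^-1)%:E *
    \int[tuple_measure leb k]_(x in @tuples_in R d (domain d L) k `&`
      @config_of R d k @^-1` E) weight phi (cst lam%:E) x =
    K [set: vtx]%SET fset0 (fun xi => (\1_E xi)%:E).
  apply: eq_eseriesr => k _; congr (_ * _); rewrite regionT// -tE integral_mkcondr.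
  apply: eq_integral => x _; rewrite patchE indicE.
  have -> : (config_of x \in E) = (x \in @config_of R d k @^-1` E).
    by apply/idP/idP => /set_mem ?; exact/mem_set.
  by case: (x \in _); rewrite ?mule1 ?mule0.
have den : partition_fun phi (cst lam%:E) (domain d L) = K [set: vtx]%SET fset0 (fun=> 1).
  by rewrite tE -(regionT L r_gt0); exact: partition_fun_gker.
by rewrite /gibbs num den.
Qed.

Lemma gspec_indic_fin C zeta (E : set cfg) : measurable E ->
  gspec C zeta (fun eta => (\1_E eta)%:E) \is a fin_num.
Proof.
move=> mE; have H := sigma_functional_gspec r_gt0 lam_gt0 phi_rep C zeta.
have nE := nnmeasurable_indic (R := R) mE.
have nE' := nnmeasurable_indic (R := R) (measurableC mE).
rewrite ge0_fin_numE; last exact: (sfun_ge0 H).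
apply: (@le_lt_trans _ _ (gspec C zeta (fun=> 1))); last exact: gker1_fin.
have -> : (fun _ : cfg => 1 : \bar R) =
    (fun eta => (\1_E eta)%:E + (\1_(~` E) eta)%:E).
  apply/funext => eta; rewrite !indicE -EFinD in_setC.
  by case: (eta \in E); rewrite ?addr0 ?add0r.
by rewrite (sfunD H)// leeDl//; exact: (sfun_ge0 H).
Qed.

Lemma rs_glue A C eta xi : A \subset (~: C)%SET ->
  rs A (rs (~: C)%SET eta `|` rs C xi)%fset = rs A eta.
Proof.
move=> AC; rewrite rsU !rsI//; have /finset.setIidPl -> := AC.
have -> : (A :&: C)%SET = finset.set0.
  apply/setP => w; rewrite !inE; apply/negP => /andP[/(fintype.subsetP AC)].
  by rewrite inE => /negP.
by rewrite rs0 fsetU0.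
Qed.

Lemma vballC (v w : vtx) k : (w \in vball v k) = (v \in vball w k).
Proof. by rewrite !inE; apply: eq_forallb => i; rewrite andbC. Qed.

(** * Acceptance and resampling for a fixed vertex of the unresolved region *)

Section fixed_update.
Variables (S : {set vtx}) (v : vtx).
Hypothesis vS : v \in S.
Let B := upd S v ell.
Let Bv := (B :\ v)%SET.
Let H := (~: (S :|: B))%SET.

Let ZB eta := K B (rs (bd B) eta) (fun=> 1).
Let ZBv eta := K Bv (rs (v |: bd B)%SET eta) (fun=> 1).
Let kap eta : \bar R := (kappa S v (rs S eta))%:E.

(** The filter is evaluated on the part of the configuration in [S]. This agrees with [accept] on
    configurations in the domain, and is measurable and local on all configurations. *)
Definition acceptance eta : \bar R := kap eta * (ZB eta / ZBv eta).

Let bd_far x y : x \notin B -> x \notin bd B -> y \in B -> y \notin vball x 1.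
Proof.
move=> xB; rewrite inE xB/= => /existsPn H1 yB.
by have := H1 y; rewrite yB/= vballC.
Qed.

(** Beyond the boundary layer [bd B] nothing interacts with [B], so the partition function of the
    algorithm is the mass of the kernel with full boundary condition. For [Bv] the box [v] itself
    joins the boundary. *)
Let ZBE eta : K B (rs (~: B)%SET eta) (fun=> 1) = ZB eta.
Proof.
apply: gker_ext => // y By; apply: (tilted_far lam r_gt0 phi_rep eta _ _ By).
  by apply/fintype.subsetP => w; rewrite !inE => /andP[].
by move=> x w; rewrite !finset.in_setD finset.in_setC => /andP[xb xB] wB; exact: bd_far.
Qed.

Let ZBvE eta : K Bv (rs (~: Bv)%SET eta) (fun=> 1) = ZBv eta.
Proof.
apply: gker_ext => // y By; apply: (tilted_far lam r_gt0 phi_rep eta _ _ By).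
  apply/fintype.subsetP => w; rewrite finset.in_setU1 finset.in_setC finset.in_setD1.
  by case: eqVneq => //= _; rewrite inE => /andP[].
move=> x w; rewrite finset.in_setD finset.in_setU1 negb_or finset.in_setC finset.in_setD1.
move=> /andP[/andP[-> xb] xB]; rewrite finset.in_setD1 => /andP[_ wB].
exact: bd_far.
Qed.

Lemma acceptE eta : configs_in (domain d L) eta ->
  accept phi lam ell kappa S v eta = acceptance eta.
Proof.
move=> eD; rewrite /accept !partition_fun_gker /acceptance /kap.
by have [_ -> // _] := kappa_bfc.2 _ _ vS.
Qed.

Let kap_ge0 eta : 0 <= kap eta.
Proof.
rewrite lee_fin; have := kappa_bfc.1 S v (rs S eta).
by move=> /(_ (@rs_domain _ _ _ _ S eta)) /andP[].
Qed.

Let nn_kap : nnmeasurable (kap : cfg -> \bar R).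
Proof.
split => //; apply: measurableT_comp; first exact: EFin_measurable.
have [mk _ _] := kappa_bfc.2 _ _ vS.
apply: (measurable_comp _ _ mk (measurable_rs S)); last first.
  by move=> _ [eta _ <-]; exact: rs_domain.
have md : measurable (~` (domain d L : set pt)).
  apply: measurableC; rewrite -(regionT L r_gt0); exact: measurable_region.
have := measurable_count [set 0%N] md; congr (measurable _).
apply/seteqP; split => eta /=.
  move=> e0 x xe; apply: contrapT => nx.
  have : x \in restr (~` (domain d L : set pt)) eta.
    by rewrite in_restr xe; exact/mem_set.
  by move/cardfs0_eq : e0 => ->; rewrite inE.
move=> h; apply/eqP; rewrite cardfs_eq0; apply/eqP/fsetP => x.
rewrite in_restr inE; apply/negP => /andP[/h dx /set_mem]; exact.
Qed.

Lemma nnmeasurable_kappa : nnmeasurable (kap : cfg -> \bar R).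
Proof. exact: nn_kap. Qed.

Let nn_K1 A C : nnmeasurable (fun eta : cfg => K C (rs A eta) (fun=> 1)).
Proof.
apply: (nnmeasurable_gker lam_gt0 phi_rep A C (f := fun=> 1)).
exact: nnmeasurable_cst.
Qed.

Let nn_invK1 A C : nnmeasurable (fun eta : cfg => (K C (rs A eta) (fun=> 1))^-1).
Proof.
split; last by move=> eta; rewrite inve_ge0 ltW.
under eq_fun do rewrite invK1.
apply: measurableT_comp; first exact: EFin_measurable.
under eq_fun do rewrite -powR_inv1 ?fine_ge0 ?(ltW (K1_gt0 _ _))//.
apply: (measurableT_comp (measurable_powR (-1))).
exact: (measurableT_comp _ (nn_K1 A C).1).
Qed.

Lemma nnmeasurable_acceptance : nnmeasurable (acceptance : cfg -> \bar R).
Proof.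
apply: nnmeasurableM => //; apply: nnmeasurableM; first exact: nn_K1.
exact: nn_invK1.
Qed.

Lemma acceptance_fin eta : acceptance eta \is a fin_num.
Proof.
rewrite /acceptance fin_numM// fin_numM//; first exact: K1_fin.
by rewrite /ZBv invK1.
Qed.

(** This explains why a rejection adds [bd B] to [S]: the outcome of the coin then reveals nothing
    beyond the new unresolved region. *)
Lemma acceptance_local A eta : S \subset A -> bd B \subset A ->
  acceptance (rs A eta) = acceptance eta.
Proof.
move=> SA bA.
have e C : C \subset A -> rs C (rs A eta) = rs C eta.
  by move=> CA; rewrite (rsI r_gt0) (finset.setIidPl CA).
have vbA : (v |: bd B)%SET \subset A.
  by rewrite finset.subUset bA finset.sub1set (fintype.subsetP SA).
by rewrite /acceptance /kap /ZB /ZBv (e _ SA) (e _ bA) (e _ vbA).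
Qed.

(** The law of [Y] as a functional. Its argument only receives configurations restricted to [B], so
    that events on points outside [B] are visibly null. *)
Definition resampled eta (f : cfg -> \bar R) : \bar R :=
  (ZB eta)^-1 * K B (rs (~: B)%SET eta) (fun xi => f (rs B xi)).

Lemma resampled_ext eta (f g : cfg -> \bar R) :
  (forall xi, f (rs B xi) = g (rs B xi)) -> resampled eta f = resampled eta g.
Proof.
move=> fg; rewrite /resampled.
by have -> : (fun xi : cfg => f (rs B xi)) = (fun xi => g (rs B xi)) by exact/funext.
Qed.

Lemma resampleE eta (E : set cfg) : configs_in (domain d L) eta ->
  resample phi lam ell S v eta E = resampled eta (fun xi => (\1_E xi)%:E).
Proof.
move=> eD; rewrite /resample /pushforward.
have -> : restr (domain d L `\` region (upd S v ell)) eta = rs (~: B)%SET eta.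
  congr restr; rewrite -(regionT L r_gt0); apply/seteqP; split => x.
    by move=> [[w _ bw] nB]; exists w => //; rewrite inE; apply/negP => wB; apply: nB; exists w.
  move=> [w]; rewrite inE => wB bw; split; first by exists w.
  by move=> [u uB bu]; move: wB; rewrite (box_inj r_gt0 bw bu) uB.
rewrite gibbs_restr_gker; last exact: region_domain.
rewrite ZBE muleC; congr (_ * _); exact: gker_ext.
Qed.

Lemma sigma_functional_resampled eta : sigma_functional (resampled eta).
Proof.
have HK := sigma_functional_gker lam_gt0 phi_rep B (rs (~: B)%SET eta).
have c0 : (0 <= (fine (ZB eta))^-1)%R by rewrite invr_ge0 fine_ge0// (ltW (K1_gt0 _ _)).
rewrite /resampled /ZB invK1; apply: (sigma_functionalZ c0).
exact: (sigma_functional_comp (measurable_rs B) HK).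
Qed.

Lemma nnmeasurable_resampled (f : cfg * cfg -> \bar R) : nnmeasurable f ->
  nnmeasurable (fun eta : cfg => resampled eta (fun xi => f (eta, xi))).
Proof.
move=> nf; apply: nnmeasurableM; first exact: nn_invK1.
apply: (nnmeasurable_gker lam_gt0 phi_rep (~: B)%SET B
  (f := fun p : cfg * cfg => f (p.1, rs B p.2))).
have m : measurable_fun setT (fun p : cfg * cfg => (p.1, rs B p.2 : cfg)).
  apply: measurable_fun_pair; first exact: measurable_fst.
  exact: (measurableT_comp (measurable_rs B) measurable_snd).
exact: (nnmeasurable_comp m nf).
Qed.

Lemma resampled_glue eta (f : cfg -> \bar R) :
  resampled eta (fun xi => f (rs (~: B)%SET eta `|` rs B xi)%fset) =
  (ZB eta)^-1 * gspec B eta f.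
Proof.
have e : K B (rs (~: B)%SET eta) (fun xi =>
    f (rs (~: B)%SET eta `|` rs B (rs B xi))%fset) = gspec B eta f.
  by apply: gker_ext => [//|xi _]; rewrite (rsI r_gt0) finset.setIid.
by rewrite /resampled e.
Qed.

(* The normalising constants cancel: resampling undoes the bias that the
   acceptance probability puts on the configuration outside the update. *)
Lemma gspec_accept zeta (E : set cfg) : measurable E ->
  gspec (~: S)%SET zeta (fun eta => acceptance eta *
    resampled eta (fun xi => (\1_E (rs (~: B)%SET eta `|` rs B xi)%fset)%:E)) =
  kap zeta * gspec (~: (S :\ v))%SET zeta (fun eta => (\1_E eta)%:E).
Proof.
move=> mE; have nE := nnmeasurable_indic (R := R) mE.
have nG := nnmeasurable_gspec r_gt0 lam_gt0 phi_rep B nE.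
set G := (fun eta : cfg => gspec B eta (fun eta => (\1_E eta)%:E)) in nG *.
have inB w : (w \in B) = (w == v) || ((w \notin S) && (w \in vball v ell)).
  by rewrite /B /upd finset.in_setU1 finset.in_setD.
have SBv : (~: S)%SET = (H :|: Bv)%SET.
  apply/setP => w; rewrite finset.in_setC finset.in_setU finset.in_setD1.
  rewrite finset.in_setC finset.in_setU !inB.
  have [->|wv] := eqVneq w v; first by rewrite ?vS.
  by case: (w \in S); case: (w \in vball v ell).
have HBv : (H :&: Bv)%SET = finset.set0.
  apply/setP => w; rewrite finset.in_setI finset.in_set0 finset.in_setD1.
  rewrite finset.in_setC finset.in_setU !inB.
  have [->|wv] := eqVneq w v; first by rewrite ?vS.
  by case: (w \in S); case: (w \in vball v ell).
have HB : (H :&: B)%SET = finset.set0.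
  apply/setP => w; rewrite finset.in_setI finset.in_set0.
  rewrite finset.in_setC finset.in_setU !inB.
  have [->|wv] := eqVneq w v; first by rewrite ?vS.
  by case: (w \in S); case: (w \in vball v ell).
have SvB : (~: (S :\ v))%SET = (H :|: B)%SET.
  apply/setP => w; rewrite finset.in_setC finset.in_setU finset.in_setD1.
  rewrite finset.in_setC finset.in_setU !inB.
  have [->|wv] := eqVneq w v; first by rewrite ?vS.
  by case: (w \in S); case: (w \in vball v ell).
have SsubBv : S \subset (~: Bv)%SET.
  apply/fintype.subsetP => w wS; rewrite finset.in_setC finset.in_setD1 inB wS/= orbF.
  by case: (w == v).
have SsubH : S \subset (~: H)%SET.
  by apply/fintype.subsetP => w wS; rewrite !finset.in_setC finset.in_setU wS.
have bdsub : (v |: bd B)%SET \subset (~: Bv)%SET.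
  apply/fintype.subsetP => w; rewrite finset.in_setU1 finset.in_setC finset.in_setD1.
  by case: eqVneq => //= _; rewrite inE => /andP[].
have Bsub : (~: B)%SET \subset (~: Bv)%SET.
  apply/fintype.subsetP => w; rewrite !finset.in_setC finset.in_setD1 negb_and => ->.
  by rewrite orbT.
(* [acceptance] has [ZB] in the numerator and [resampled] has it in the denominator; [Psi] is what
   remains of the product. *)
pose Psi eta := kap eta * ((ZBv eta)^-1 * G eta).
have nPsi : nnmeasurable (Psi : cfg -> \bar R).
  apply: nnmeasurableM => //; apply: nnmeasurableM => //; exact: nn_invK1.
have -> : (fun eta : cfg => acceptance eta * resampled eta (fun xi =>
    (\1_E (rs (~: B)%SET eta `|` rs B xi)%fset)%:E)) = Psi.
  apply/funext => eta; rewrite (resampled_glue eta (fun eta => (\1_E eta)%:E)) -/(G eta).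
  rewrite /acceptance /Psi -!muleA; congr (_ * _).
  rewrite muleCA; congr (_ * _); rewrite muleA.
  by rewrite (divee (K1_fin _ _) (K1_neq0 _ _)) mul1e.
rewrite SBv (gspec_chain d_gt0 r_gt0 lam_gt0 phi_rep zeta nPsi HBv).
have fPsi eta : Psi eta \is a fin_num.
  rewrite /Psi !fin_numM//; last exact: gspec_indic_fin.
  by rewrite /ZBv invK1.
(* [Psi] does not see the old points in [Bv]. Integrating them out therefore only produces their
   mass [ZBv], which cancels the remaining denominator. *)
have step eta : gspec Bv eta Psi = kap eta * G eta.
  have n1 : nnmeasurable (fun _ : cfg => 1 : \bar R) by exact: nnmeasurable_cst.
  have -> : Psi = (fun xi => Psi xi * 1) by apply/funext => xi; rewrite mule1.
  rewrite (gspecM r_gt0 lam_gt0 phi_rep (nPsi.2 eta) (fPsi eta) n1); last first.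
    move=> xi; set u := (_ `|` _)%fset.
    have e1 : kap u = kap eta by rewrite /kap (rs_glue _ _ SsubBv).
    have e2 : ZBv u = ZBv eta by rewrite /ZBv (rs_glue _ _ bdsub).
    have e3 : G u = G eta by apply: gspec_rs; rewrite (rs_glue _ _ Bsub).
    by rewrite /Psi e1 e2 e3.
  rewrite /gspec ZBvE /Psi -!muleA; congr (_ * _).
  rewrite [(ZBv eta)^-1 * _]muleC -muleA -[RHS]mule1; congr (_ * _).
  exact: divee (K1_fin _ _) (K1_neq0 _ _).
have -> : (fun eta : cfg => gspec Bv eta Psi) = (fun eta => kap eta * G eta).
  by apply/funext => eta; exact: step.
have kf : kap zeta \is a fin_num by [].
have kl xi : kap (rs (~: H)%SET (rs (~: Bv)%SET zeta) `|` rs H xi)%fset = kap zeta.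
  by rewrite /kap (rs_glue _ _ SsubH) (rsI r_gt0) (finset.setIidPl SsubBv).
rewrite (gspecM r_gt0 lam_gt0 phi_rep (kap_ge0 zeta) kf nG kl).
congr (_ * _); rewrite SvB (gspec_chain d_gt0 r_gt0 lam_gt0 phi_rep zeta nE HB) -/G.
have e1 : rs (~: H)%SET (rs (~: Bv)%SET zeta) = rs S zeta.
  by rewrite rsI// -finset.setCU -SBv finset.setCK.
have e2 : rs (~: H)%SET (rs (~: B)%SET zeta) = rs (S :\ v)%SET zeta.
  by rewrite rsI// -finset.setCU -SvB finset.setCK.
(* The two kernels on [H] differ in whether the points in the box [v] belong to the boundary
   condition. As [0 < ell], all boxes adjacent to [v] lie in [S] or [B], so these points do not
   reach [H]. *)
rewrite /gspec e1 e2; apply: gker_ext.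
  move=> y Hy; apply: (tilted_far lam r_gt0 phi_rep zeta _ _ Hy); first exact: finset.subD1set.
  move=> x w; rewrite finset.in_setD finset.in_setD1 negb_and negbK => /andP[xv xS].
  have -> : x = v by move: xv; rewrite xS orbF => /eqP.
  rewrite finset.in_setC finset.in_setU inB !negb_or => /andP[wS /andP[wv]].
  rewrite wS/=; apply: contra; rewrite !inE => /forallP h; apply/forallP => i.
  have /andP[h1 h2] := h i.
  by rewrite (leq_trans h1) ?(leq_trans h2)// leq_add2l.
(* The kernel on [B] overwrites the box [v], so its old content is irrelevant to [G] as well. *)
move=> xi _; rewrite /G; apply: gspec_rs; rewrite !rsU; congr (_ `|` _)%fset.
rewrite !rsI//; congr rs; apply/setP => w.
rewrite !finset.in_setI finset.in_setC finset.in_setD1 inB.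
by case: (w == v).
Qed.

(** The complement of [S] is split into the newly exposed part [S' :\: S] and the rest; [b], later
    the rejection weight, only sees [S'] and hence leaves the inner kernel. *)
Lemma gspec_reject (S' : {set vtx}) zeta (b : cfg -> \bar R) (E : set cfg) : S \subset S' ->
  nnmeasurable b -> (forall eta, b eta \is a fin_num) ->
  (forall eta : {fset pt}, b (rs S' eta) = b eta) -> measurable E ->
  gspec (~: S)%SET zeta (fun eta => b eta * (\1_E eta)%:E) =
  gspec (S' :\: S)%SET (rs S' zeta)
    (fun eta => b eta * gspec (~: S')%SET eta (fun eta => (\1_E eta)%:E)).
Proof.
move=> SS' nb fb bl mE; have nE := nnmeasurable_indic (R := R) mE.
have -> : (~: S)%SET = ((S' :\: S) :|: ~: S')%SET.
  apply/setP => w; rewrite finset.in_setU finset.in_setD !finset.in_setC.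
  have [wS|wS] := boolP (w \in S); first by rewrite (fintype.subsetP SS' _ wS).
  by case: (w \in S').
rewrite (gspec_chain d_gt0 r_gt0 lam_gt0 phi_rep zeta (nnmeasurableM nb nE)); last first.
  by apply/setP => w; rewrite !inE; case: (w \in S'); rewrite ?andbF.
rewrite finset.setCK; congr gspec; apply/funext => eta.
rewrite (gspecM r_gt0 lam_gt0 phi_rep (nb.2 eta) (fb eta) nE)// => xi.
by rewrite -[LHS]bl rs_glue ?bl// finset.setCK.
Qed.

End fixed_update.
End update_step.

(** * The process *)

Section process.
Context {R : realType} {d : nat}.
Variables (L r lam : R) (phi : rpoint R d -> rpoint R d -> \bar R) (ell : nat).
Variable kappa : {set vertex d L r} -> vertex d L r -> {fset rpoint R d} -> R.
Hypothesis d_gt0 : (0 < d)%N.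
Hypothesis r_gt0 : 0 < r.
Hypothesis lam_gt0 : 0 < lam.
Hypothesis ell_gt0 : (0 < ell)%N.
Hypothesis phi_rep : repulsive_potential r phi.
Hypothesis kappa_bfc : bayes_filter_correction phi lam ell kappa.
Local Notation vtx := (vertex d L r).
Local Notation pt := (rpoint R d).
Local Notation cfg := (config R d).
Context {disp : measure_display} {Omega : measurableType disp}.
Variables (P : probability Omega R)
  (S : nat -> Omega -> {set vtx}) (v : nat -> Omega -> vtx)
  (F : nat -> Omega -> bool) (Y X : nat -> Omega -> cfg).
Hypothesis proc : algorithm_process phi lam ell kappa P S v F Y X.
Local Notation K := (gker lam phi).
Local Notation gspec := (gspec lam phi).
Local Notation hist := (history S v F Y X).
Local Open Scope ereal_scope.

Lemma history_setI t (D E : set Omega) : hist t D -> hist t E -> hist t (D `&` E).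
Proof.
exact: (@measurableI _ (g_sigma_algebraType (history_event S v F Y X t)) D E).
Qed.

Lemma historyS t (D : set Omega) : hist t D -> hist t.+1 D.
Proof.
apply: sub_sigma_algebra2 => _ [s S0 st|s A st mA|s v0 st|s b st|s A st mA].
- by apply: HistS; exact: leqW.
- by apply: HistX => //; exact: leqW.
- by apply: Histv; exact: leqW.
- by apply: HistF; exact: leqW.
- by apply: HistY => //; exact: leqW.
Qed.

Let mpre d1 d2 (T : measurableType d1) (U : measurableType d2) (f : T -> U)
    (A : set U) :
  measurable_fun setT f -> measurable A -> measurable (f @^-1` A).
Proof. by move=> mf mA; rewrite -[X in measurable X]setTI; exact: mf. Qed.

Lemma history_measurable t (D : set Omega) : hist t D -> measurable D.
Proof.
apply: smallest_sub; first exact: sigma_algebra_measurable.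
move=> _ [s S0 st|s A st mA|s v0 st|s b st|s A st mA].
- exact: (process_measS proc).
- exact: mpre (process_measX proc s) mA.
- exact: (process_measv proc).
- exact: (process_measF proc).
- exact: mpre (process_measY proc s) mA.
Qed.

Let Pfin (E : set Omega) : measurable E -> P E \is a fin_num.
Proof. by move=> mE; exact: fin_num_measure. Qed.

(* On [D], the configuration outside [region S0] is conditionally Gibbs given
   the configuration in [region S0]. *)
Definition gibbs_outside t (S0 : {set vtx}) (D : set Omega) : Prop :=
  [/\ hist t D, D `<=` [set w | S t w = S0] &
    exists2 Phi : (cfg -> \bar R) -> \bar R, sigma_functional Phi &
    forall A : set cfg, measurable A -> P (D `&` X t @^-1` A) =
      Phi (fun zeta => gspec (~: S0)%SET zeta (fun eta => (\1_A eta)%:E))].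

(** * One round on a branch with given unresolved region and vertex *)

Section one_round.
Variables (s : nat) (S0 : {set vtx}) (v0 : vtx) (D : set Omega).
Variable Phi : (cfg -> \bar R) -> \bar R.
Hypothesis vS : v0 \in S0.
Hypothesis HD : hist s D.
Hypothesis DS : D `<=` [set w | S s w = S0].
Hypothesis HPhi : sigma_functional Phi.
Hypothesis HP : forall A : set cfg, measurable A -> P (D `&` X s @^-1` A) =
  Phi (fun zeta => gspec (~: S0)%SET zeta (fun eta => (\1_A eta)%:E)).
Let B := upd S0 v0 ell.
Let acc : cfg -> \bar R := acceptance lam phi ell kappa S0 v0.
Let c : R := ((#|S0|%:R)^-1)%R.
Let Psi (f : cfg -> \bar R) : \bar R := c%:E * Phi (fun zeta => gspec (~: S0)%SET zeta f).
Let Dv := D `&` [set w | v s w = v0].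
Let DF := Dv `&` [set w | F s w].
Let Dn := Dv `&` [set w | F s w = false].

Let mX : measurable_fun setT (X s). Proof. exact: process_measX proc s. Qed.
Let mY : measurable_fun setT (Y s). Proof. exact: process_measY proc s. Qed.
Let mD : measurable D. Proof. exact: history_measurable HD. Qed.
Let mDv : measurable Dv.
Proof. by apply: measurableI => //; exact: process_measv proc _ _. Qed.
Let mDF : measurable DF.
Proof. by apply: measurableI => //; exact: process_measF proc s true. Qed.
Let mDn : measurable Dn.
Proof. by apply: measurableI => //; exact: process_measF proc s false. Qed.

Let c_ge0 : (0 <= c)%R. Proof. by rewrite invr_ge0. Qed.

Let sPsi : sigma_functional Psi.
Proof.
apply: sigma_functionalZ => //; apply: (sigma_functional_bind HPhi).
  by move=> zeta; exact: sigma_functional_gspec.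
by move=> f nf; exact: nnmeasurable_gspec.
Qed.

Let nacc : nnmeasurable acc. Proof. exact: nnmeasurable_acceptance. Qed.

Let nI (A : set cfg) : measurable A ->
  nnmeasurable (fun eta : cfg => (\1_A eta)%:E : \bar R).
Proof. exact: nnmeasurable_indic. Qed.

Let HistX0 (A : set cfg) : measurable A -> hist s (D `&` X s @^-1` A).
Proof.
by move=> mA; apply: history_setI => //; apply: sub_sigma_algebra; exact: HistX.
Qed.

Lemma vertex_law (A : set cfg) : measurable A ->
  P (Dv `&` X s @^-1` A) = Psi (fun eta => (\1_A eta)%:E).
Proof.
move=> mA; rewrite /Psi -HP//.
have := process_v proc vS (HistX0 mA).
have -> : D `&` X s @^-1` A `&` [set w | S s w = S0] = D `&` X s @^-1` A.
  by apply/setIidPl => w [Dw _]; exact: DS.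
rewrite integral_cst; last exact: (measurableI _ _ mD (mpre mX mA)).
by move=> <-; congr (P _); rewrite /Dv setIAC.
Qed.

Let law_in (E : set Omega) (Q : (cfg -> \bar R) -> \bar R) : measurable E ->
  sigma_functional Q ->
  (forall A, measurable A -> P (E `&` X s @^-1` A) = Q (fun eta => (\1_A eta)%:E)) ->
  forall h A, nnmeasurable h -> measurable A ->
  \int[P]_(w in E `&` X s @^-1` A) h (X s w) = Q (fun eta => (\1_A eta)%:E * h eta).
Proof.
move=> mE sQ HQ h A nh mA.
apply: (sigma_functional_law (Psi := fun f => Q (fun eta => (\1_A eta)%:E * f eta))
  (measurableI _ _ mE (mpre mX mA)) mX _ _ nh).
  exact: (sigma_functional_mul sQ (nI mA)).
move=> A' mA'; rewrite -setIA -preimage_setI HQ; last exact: measurableI.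
by congr Q; apply/funext => eta; rewrite indicI EFinM.
Qed.

Lemma accept_law (A : set cfg) : measurable A ->
  P (DF `&` X s @^-1` A) = Psi (fun eta => acc eta * (\1_A eta)%:E).
Proof.
move=> mA; have := process_F proc vS (HistX0 mA).
have -> : D `&` X s @^-1` A `&` [set w | S s w = S0 /\ v s w = v0] = Dv `&` X s @^-1` A.
  apply/seteqP; split => w /=; first by move=> [[? ?] [_ ?]].
  by move=> [[Dw vw] Aw]; split=> //; split=> //; exact: DS.
have -> : Dv `&` X s @^-1` A `&` [set w | F s w] = DF `&` X s @^-1` A.
  by rewrite setIAC.
move=> ->; transitivity (\int[P]_(w in Dv `&` X s @^-1` A) acc (X s w)).
  apply: eq_integral => w _; apply: (acceptE kappa_bfc vS).
  exact: (process_inX proc).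
rewrite (law_in mDv sPsi vertex_law nacc mA).
by congr Psi; apply/funext => eta; rewrite muleC.
Qed.

Let PsiF (f : cfg -> \bar R) := Psi (fun eta => acc eta * f eta).
Let sPsiF : sigma_functional PsiF.
Proof. exact: (sigma_functional_mul sPsi nacc). Qed.

Let resam (eta : cfg) (f : cfg -> \bar R) := resampled lam phi ell S0 v0 eta f.

Let Psi2 (f : cfg * cfg -> \bar R) :=
  PsiF (fun eta => resam eta (fun xi => f (eta, xi))).

Let sPsi2 : sigma_functional Psi2.
Proof.
apply: (sigma_functional_bind (K := fun eta f => resam eta (fun xi => f (eta, xi))) sPsiF).
  move=> eta; have m : measurable_fun setT (fun xi : cfg => (eta, xi)).
    by apply: measurable_fun_pair; [exact: measurable_cst|exact: measurable_id].
  exact: (sigma_functional_comp m (sigma_functional_resampled ell r_gt0 lam_gt0 phi_rep S0 v0 eta)).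
by move=> f nf; exact: (nnmeasurable_resampled ell r_gt0 lam_gt0 phi_rep S0 v0 nf).
Qed.

(** The next configuration mixes [X s] and [Y s], so their separate laws would not suffice. *)
Lemma joint_law (C : set (cfg * cfg)) : measurable C ->
  P (DF `&` [set w | C (X s w, Y s w)]) = Psi2 (fun p => (\1_C p)%:E).
Proof.
apply: sigma_functional_joint_law => // A1 A2 mA1 mA2.
have := process_Y proc vS mA2 (HistX0 mA1).
have -> : D `&` X s @^-1` A1 `&` [set w | [/\ S s w = S0, v s w = v0 & F s w]] =
    DF `&` X s @^-1` A1.
  apply/seteqP; split => w /=; first by move=> [[? ?] [? ? ?]].
  by move=> [[[Dw vw] Fw] Aw]; split => //; split => //; exact: DS.
move=> ->.
have nR : nnmeasurable (fun eta : cfg => resam eta (fun xi => (\1_A2 xi)%:E)).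
  apply: (nnmeasurable_resampled ell r_gt0 lam_gt0 phi_rep S0 v0
    (f := fun p : cfg * cfg => (\1_A2 p.2)%:E)).
  exact: (nnmeasurable_comp measurable_snd (nI mA2)).
transitivity (\int[P]_(w in DF `&` X s @^-1` A1) resam (X s w) (fun xi => (\1_A2 xi)%:E)).
  apply: eq_integral => w _; apply: (resampleE lam ell r_gt0 phi_rep).
  exact: (process_inX proc).
rewrite (law_in mDF sPsiF accept_law nR mA1); congr PsiF; apply/funext => eta.
have sR := sigma_functional_resampled ell r_gt0 lam_gt0 phi_rep S0 v0 eta.
have i0 : (0 <= \1_A1 eta :> R)%R by [].
rewrite -(sfunZ sR i0 (nI mA2)); congr resam; apply/funext => xi.
by rewrite -EFinM !indicE in_setX; case: (eta \in A1); rewrite ?mul1r ?mul0r.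
Qed.

Lemma accepted_config w : DF w -> rs B (Y s w) = Y s w ->
  X s.+1 w = (rs (~: B)%SET (X s w) `|` rs B (Y s w))%fset.
Proof.
move=> [[Dw vw] Fw] Yw; have Sw := DS Dw; rewrite /= in Sw vw.
have Sn0 : S s w != finset.set0 by rewrite Sw; apply/set0Pn; exists v0.
have [-> _] := process_accept proc Sn0 Fw; rewrite Sw vw -/B Yw; congr fsetU.
apply/fsetP => x; rewrite !in_restr; apply: andb_id2l => xX.
have := @process_inX _ _ _ _ _ _ _ _ _ _ _ _ _ _ _ _ proc s w x xX.
rewrite -(regionT L r_gt0) => -[u _ bu].
apply/idP/idP => /set_mem h; apply/mem_set.
  by exists u => //; rewrite finset.in_setC; apply/negP => uB; apply: h; exists u.
move=> [u' uB bu']; case: h => u''; rewrite finset.in_setC => uB' bu''.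
by move: uB'; rewrite (box_inj r_gt0 bu'' bu') uB.
Qed.

Lemma accepted_round (A : set cfg) : measurable A ->
  P (DF `&` X s.+1 @^-1` A) = c%:E * Phi (fun zeta =>
    (kappa S0 v0 (rs S0 zeta))%:E *
    gspec (~: (S0 :\ v0))%SET zeta (fun eta => (\1_A eta)%:E)).
Proof.
move=> mA.
have BB : (~: B :&: B)%SET = finset.set0 by rewrite finset.setIC finset.setICr.
pose C := [set p : cfg * cfg | A (rs (~: B)%SET p.1 `|` rs B p.2)%fset].
have mC : measurable C by exact: mpre (measurable_glue r_gt0 BB) mA.
(* The law of [Y s] is supported in [region B], which holds for the variable itself only almost
   surely: [N] describes the exceptions, and [PM] shows that they are null. *)
pose N := [set p : cfg * cfg | (#|` restr (~` region B) p.2| != 0)%N].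
have mN : measurable N.
  have := @measurable_count R d (~` region B) [set k | k != 0%N].
  move=> /(_ (measurableC (measurable_region B))) mM.
  exact: mpre measurable_snd mM.
have mXY := measurable_fun_pair mX mY.
pose M := DF `&` [set w | N (X s w, Y s w)].
have PM : P M = 0.
  rewrite joint_law// -[RHS](sfun0 sPsiF); congr PsiF; apply/funext => eta.
  have sR := sigma_functional_resampled ell r_gt0 lam_gt0 phi_rep S0 v0 eta.
  rewrite -[RHS](sfun0 sR); apply: resampled_ext => xi.
  rewrite indicE memNset// /N/= => /negP; apply; rewrite cardfs_eq0.
  apply/eqP/fsetP => x; rewrite !in_restr inE; apply/negP.
  by move=> /andP[/andP[_ /set_mem ?] /set_mem].
have mM : measurable M := measurableI _ _ mDF (mpre mXY mN).
have mX1 : measurable (DF `&` X s.+1 @^-1` A).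
  by apply: measurableI => //; exact: mpre (process_measX proc _) mA.
have mC' := measurableI _ _ mDF (mpre mXY mC).
have null E : measurable E -> P E = P (E `\` M).
  move=> mE; rewrite measureD//; last by rewrite ltey_eq Pfin.
  rewrite [X in _ = _ - X](_ : _ = 0) ?sube0//.
  apply/eqP; rewrite -measure_le0 -PM le_measure// ?inE//; exact: measurableI.
transitivity (P (DF `&` [set w | C (X s w, Y s w)])).
  rewrite (null _ mX1) (null _ mC'); congr (P _).
  have YB w : DF w -> ~ M w -> rs B (Y s w) = Y s w.
    move=> DFw nM; apply: rs_id => x xY; apply: contrapT => nB; apply: nM; split => //.
    apply/negP; rewrite cardfs_eq0 => /eqP/fsetP/(_ x).
    by rewrite in_restr xY inE mem_set.
  apply/seteqP; split => w [[DFw H1] H2]; split => //; split => //.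
    by move: H1; rewrite /= /C/= (accepted_config DFw (YB w DFw H2)).
  by move: H1; rewrite /= /C/= (accepted_config DFw (YB w DFw H2)).
rewrite (joint_law mC); congr (_ * Phi _); apply/funext => zeta.
exact: (gspec_accept d_gt0 r_gt0 lam_gt0 ell_gt0 phi_rep kappa_bfc vS zeta mA).
Qed.

(** [slack] and [excess] are the positive and negative parts of [1 - acc], since functionals only
    take nonnegative arguments. The rejection weight is [slack] once [excess] is known to be
    null. *)
Let excess (eta : cfg) : \bar R := (Num.max 0 (fine (acc eta) - 1))%R%:E.
Let slack (eta : cfg) : \bar R := (Num.max 0 (1 - fine (acc eta)))%R%:E.

Let mfine_acc : measurable_fun setT (fun eta : cfg => fine (acc eta)).
Proof. exact: (measurableT_comp _ nacc.1). Qed.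

Let nexcess : nnmeasurable excess.
Proof.
split; last by move=> eta; rewrite lee_fin le_max lexx.
apply: measurableT_comp; first exact: EFin_measurable.
apply: measurable_maxr; first exact: measurable_cst.
by apply: measurable_funB => //; exact: measurable_cst.
Qed.

Let nslack : nnmeasurable slack.
Proof.
split; last by move=> eta; rewrite lee_fin le_max lexx.
apply: measurableT_comp; first exact: EFin_measurable.
apply: measurable_maxr; first exact: measurable_cst.
by apply: measurable_funB => //; exact: measurable_cst.
Qed.

Let acc_slack eta : acc eta + slack eta = 1 + excess eta.
Proof.
have af : acc eta \is a fin_num by exact: acceptance_fin.
rewrite -(fineK af) /slack /excess -!EFinD; congr EFin.
move: (fine (acc eta)) => x; have [x1|x1] := leP x 1%R.
  by rewrite max_r ?subr_ge0// max_l ?subr_le0// addrC subrK addr0.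
by rewrite max_l ?subr_le0 ?ltW// max_r ?subr_ge0 ?ltW// addr0 addrC subrK.
Qed.

Lemma rejected_law (A : set cfg) : measurable A ->
  P (Dn `&` X s @^-1` A) = Psi (fun eta => slack eta * (\1_A eta)%:E).
Proof.
have Psi_split A' : measurable A' ->
    Psi (fun eta => acc eta * (\1_A' eta)%:E) + Psi (fun eta => slack eta * (\1_A' eta)%:E) =
    Psi (fun eta => (\1_A' eta)%:E) + Psi (fun eta => excess eta * (\1_A' eta)%:E).
  move=> mA'; rewrite -(sfunD sPsi (nnmeasurableM nacc (nI mA')) (nnmeasurableM nslack (nI mA'))).
  rewrite -(sfunD sPsi (nI mA') (nnmeasurableM nexcess (nI mA'))).
  congr Psi; apply/funext => eta; rewrite -ge0_muleDl; last 2 first.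
  - exact: nacc.2.
  - exact: nslack.2.
  rewrite acc_slack ge0_muleDl ?mul1e//; exact: nexcess.2.
have PE A' : measurable A' -> P (Dv `&` X s @^-1` A') =
    P (DF `&` X s @^-1` A') + P (Dn `&` X s @^-1` A').
  move=> mA'; have mx := mpre mX mA'.
  rewrite -measureU//; try exact: measurableI.
    congr (P _); apply/seteqP; split => w /=.
      by move=> [Dvw Aw]; case Fw : (F s w); [left|right]; split => //; split.
    by move=> [[[Dvw _] Aw]|[[Dvw _] Aw]].
  by apply/seteqP; split => w //= [[[_ Fw] _] [[_ /= Fw'] _]]; move: Fw; rewrite /= Fw'.
(* [process_F] forces the acceptance probability to be at most 1 almost surely. *)
have ex0 : Psi excess = 0.
  pose A1 := [set eta : cfg | (1 < fine (acc eta))%R].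
  have mA1 : measurable A1.
    have := mfine_acc measurableT (measurable_itv `]1%R, +oo[); rewrite setTI.
    by congr (measurable _); apply/seteqP; split => eta /=; rewrite in_itv/= andbT.
  have e1 : excess = (fun eta => excess eta * (\1_A1 eta)%:E).
    apply/funext => eta; rewrite indicE; case: (boolP (eta \in A1)); rewrite ?mule1//.
    rewrite mule0 => /negP h; rewrite /excess max_l// subr_le0 leNgt; apply/negP => h'.
    by apply: h; apply/mem_set.
  have e2 : (fun eta : cfg => slack eta * (\1_A1 eta)%:E) = fun=> 0.
    apply/funext => eta; rewrite indicE; case: (boolP (eta \in A1)); rewrite ?mule0// mule1.
    by move=> /set_mem h; rewrite /slack max_l// subr_le0 ltW.
  (* On [A1] the slack vanishes, so the accepted mass equals the total mass plus the excess; as it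
     is also at most the total mass, which is finite, the excess is null. *)
  have := Psi_split _ mA1; rewrite e2 (sfun0 sPsi) adde0 -(accept_law mA1) -(vertex_law mA1) -e1.
  have mx := mpre mX mA1.
  rewrite (PE _ mA1) => H; apply/eqP; rewrite eq_le (sfun_ge0 sPsi)// andbT.
  have fF : P (DF `&` X s @^-1` A1) \is a fin_num by apply: Pfin; exact: measurableI.
  move/(congr1 (fun z => z - P (DF `&` X s @^-1` A1))) : H.
  rewrite subee// -[X in _ = X - _]addeA addeAC subee// add0e => ->.
  by rewrite leeDr.
move=> mA.
have exA : Psi (fun eta => excess eta * (\1_A eta)%:E) = 0.
  have mA' := measurableC mA.
  have : Psi excess = Psi (fun eta => excess eta * (\1_A eta)%:E) +
                      Psi (fun eta => excess eta * (\1_(~` A) eta)%:E).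
    rewrite -(sfunD sPsi (nnmeasurableM nexcess (nI mA)) (nnmeasurableM nexcess (nI mA'))).
    congr Psi; apply/funext => eta; rewrite !indicE in_setC.
    by case: (eta \in A); rewrite ?mule1 ?mule0 ?adde0 ?add0e.
  rewrite ex0 => /esym/eqP; rewrite padde_eq0; last 2 first.
  - exact: (sfun_ge0 sPsi (nnmeasurableM nexcess (nI mA))).
  - exact: (sfun_ge0 sPsi (nnmeasurableM nexcess (nI mA'))).
  by move=> /andP[/eqP].
have := Psi_split _ mA; rewrite exA adde0 -(accept_law mA) -(vertex_law mA) (PE _ mA).
have mx := mpre mX mA.
have fF : P (DF `&` X s @^-1` A) \is a fin_num by apply: Pfin; exact: measurableI.
move=> /(congr1 (fun z => z - P (DF `&` X s @^-1` A))).
by rewrite addeAC subee// add0e addeAC subee// add0e.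
Qed.

Let S' := (S0 :|: bd B)%SET.

Lemma rejected_round (A : set cfg) : measurable A ->
  P (Dn `&` X s.+1 @^-1` A) = c%:E * Phi (fun zeta =>
    gspec (S' :\: S0)%SET (rs S' zeta) (fun eta => slack eta *
      gspec (~: S')%SET eta (fun eta => (\1_A eta)%:E))).
Proof.
move=> mA; transitivity (P (Dn `&` X s @^-1` A)).
  congr (P _); apply/seteqP; split => w [Dnw Aw]; split => //; move: Aw;
    have [[Dw vw] /= Fw] := Dnw; have /= Sw := DS Dw;
    (have Sn0 : S s w != finset.set0 by rewrite Sw; apply/set0Pn; exists v0);
    by rewrite /= (process_reject proc Sn0 (negbT Fw)).1.
have sub1 : S0 \subset S' by exact: finset.subsetUl.
have sub2 : bd B \subset S' by exact: finset.subsetUr.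
have slackf eta : slack eta \is a fin_num by [].
have slackl (eta : {fset pt}) : slack (rs S' eta) = slack eta.
  by rewrite /slack /acc (acceptance_local lam phi kappa r_gt0 vS eta sub1 sub2).
have e : (fun zeta : cfg => gspec (~: S0)%SET zeta (fun eta => slack eta * (\1_A eta)%:E)) =
    (fun zeta : cfg => gspec (S' :\: S0)%SET (rs S' zeta) (fun eta => slack eta *
      gspec (~: S')%SET eta (fun eta => (\1_A eta)%:E))).
  apply/funext => zeta.
  exact: (gspec_reject d_gt0 r_gt0 lam_gt0 phi_rep zeta sub1 nslack slackf slackl mA).
by rewrite (rejected_law mA) /Psi e.
Qed.

Let hDv : hist s.+1 Dv.
Proof.
apply: history_setI; first exact: historyS.
by apply: sub_sigma_algebra; exact: Histv.
Qed.

Lemma gibbs_outside_accept : gibbs_outside s.+1 (S0 :\ v0)%SET DF.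
Proof.
split.
- by apply: history_setI => //; apply: sub_sigma_algebra; exact: HistF.
- move=> w [[Dw vw] Fw]; have /= Sw := DS Dw.
  have Sn0 : S s w != finset.set0 by rewrite Sw; apply/set0Pn; exists v0.
  by have [_] := process_accept proc Sn0 Fw; rewrite Sw vw.
(* The uniform choice and the filter, which only depends on the configuration in [S0], become a
   factor and a density of the new functional. *)
exists (fun f => c%:E * Phi (fun zeta => (kappa S0 v0 (rs S0 zeta))%:E * f zeta)).
  apply: sigma_functionalZ => //; apply: (sigma_functional_mul HPhi).
  exact: (nnmeasurable_kappa r_gt0 kappa_bfc vS).
by move=> A mA; exact: accepted_round.
Qed.

Lemma gibbs_outside_reject : gibbs_outside s.+1 S' Dn.
Proof.
split.
- by apply: history_setI => //; apply: sub_sigma_algebra; exact: HistF.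
- move=> w [[Dw vw] /= Fw]; have /= Sw := DS Dw.
  have Sn0 : S s w != finset.set0 by rewrite Sw; apply/set0Pn; exists v0.
  by have [_] := process_reject proc Sn0 (negbT Fw); rewrite Sw vw.
(* The new functional also draws the newly exposed configuration in [S' :\: S0] from the Gibbs
   kernel, biased by the rejection weight. *)
exists (fun f => c%:E * Phi (fun zeta =>
    gspec (S' :\: S0)%SET (rs S' zeta) (fun eta => slack eta * f eta))).
  apply: sigma_functionalZ => //; apply: (sigma_functional_bind HPhi).
    move=> zeta; apply: sigma_functional_mul => //.
    exact: sigma_functional_gspec.
  move=> f nf; have nG := nnmeasurable_gspec r_gt0 lam_gt0 phi_rep
    (S' :\: S0)%SET (nnmeasurableM nslack nf).
  exact: (nnmeasurable_comp (measurable_rs S') nG).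
by move=> A mA; exact: rejected_round.
Qed.

End one_round.

(** * Splitting over vertices and outcomes, and the induction over rounds *)

Lemma measure_fibers (V : eqType) (u : Omega -> V) (q : seq V) (E : set Omega) :
  (forall x, measurable [set w | u w = x]) -> measurable E -> uniq q ->
  P (E `&` [set w | u w \in q]) = \sum_(x <- q) P (E `&` [set w | u w = x]).
Proof.
move=> mu mE; have mq (q' : seq V) : measurable [set w | u w \in q'].
  elim: q' => [|x q' IH]; first by rewrite (_ : [set w | _] = set0)//; apply/seteqP; split.
  rewrite (_ : [set w | _] = [set w | u w = x] `|` [set w | u w \in q']).
    exact: measurableU.
  apply/seteqP; split => w /=; rewrite inE; first by case/orP => [/eqP|]; [left|right].
  by case => [->|->]; rewrite ?eqxx ?orbT.
elim: q => [_|x q IH /= /andP[xq uq]].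
  rewrite big_nil (_ : _ `&` _ = set0) ?measure0//.
  by apply/seteqP; split => w // [].
rewrite big_cons -IH// -measureU//; try exact: measurableI.
  congr (P _); apply/seteqP; split => w /=.
    by move=> [Ew]; rewrite inE => /orP[/eqP|]; [left|right].
  by move=> [[Ew ->]|[Ew wq]]; rewrite inE ?eqxx ?wq ?orbT.
by apply/seteqP; split => w //= [[_ wx] [_]]; rewrite wx (negbTE xq).
Qed.

Lemma round_split t (S0 : {set vtx}) (D E : set Omega) : S0 != finset.set0 ->
  hist t D -> D `<=` [set w | S t w = S0] -> measurable E ->
  P (D `&` E) = \sum_(x in S0)
    (P (D `&` [set w | v t w = x] `&` [set w | F t w] `&` E) +
     P (D `&` [set w | v t w = x] `&` [set w | F t w = false] `&` E)).
Proof.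
move=> S00 hD DS mE; have mD := history_measurable hD.
have mv := process_measv proc t.
have mb := process_measF proc t.
pose Q := [set w | v t w \in enum S0].
have fib G : measurable G -> P (G `&` Q) = \sum_(x in S0) P (G `&` [set w | v t w = x]).
  by move=> mG; rewrite measure_fibers// ?enum_uniq// big_enum.
have mQ : measurable Q.
  rewrite (_ : Q = \bigcup_(x in [set` S0]) [set w | v t w = x]).
    exact: fin_bigcup_measurable.
  apply/seteqP; split => w; rewrite /Q/= mem_enum; first by move=> h; exists (v t w).
  by move=> [x xS /= ->].
(* The conditional probabilities of the [#|S0|] vertices add up to 1, so the chosen vertex lies in
   [S0] almost surely on [D]. *)
have PQ : P (D `&` Q) = P D.
  rewrite fib//; transitivity (\sum_(x in S0) ((#|S0|%:R : R)^-1)%:E * P D).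
    apply: eq_bigr => x xS; have := process_v proc xS hD.
    have -> : D `&` [set w | S t w = S0] = D by exact/setIidPl.
    by rewrite integral_cst.
  rewrite -(fineK (Pfin mD)) -EFinM sumEFin; congr EFin.
  by rewrite sumr_const -[LHS]mulr_natl mulrA divff ?mul1r// pnatr_eq0 cards_eq0.
have PnQ : P (D `&` ~` Q) = 0.
  have : P D = P (D `&` Q) + P (D `&` ~` Q).
    rewrite -measureU//; try (apply: measurableI => //; exact: measurableC).
      by rewrite -setIUr setUCr setIT.
    by apply/seteqP; split => w // [[_ ?] [_]].
  rewrite PQ => /(congr1 (fun z => z - P D)); have fD := Pfin mD.
  by rewrite subee// addeAC subee// add0e.
have -> : P (D `&` E) = P (D `&` E `&` Q).
  have mDE := measurableI _ _ mD mE.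
  have -> : P (D `&` E) = P (D `&` E `&` Q) + P (D `&` E `&` ~` Q).
    rewrite -measureU//; try (apply: measurableI => //; exact: measurableC).
      by rewrite -setIUr setUCr setIT.
    by apply/seteqP; split => w // [[_ ?] [_]].
  rewrite [X in _ + X](_ : _ = 0) ?adde0//.
  apply/eqP; rewrite -measure_le0 -PnQ le_measure ?inE//.
  - by apply: measurableI => //; exact: measurableC.
  - by apply: measurableI => //; exact: measurableC.
  - by move=> w [[]].
rewrite fib; last exact: measurableI.
apply: eq_bigr => x xS.
have mDx : measurable (D `&` [set w | v t w = x]) by exact: measurableI.
have mT := measurableI _ _ (measurableI _ _ mDx (mb true)) mE.
have mF := measurableI _ _ (measurableI _ _ mDx (mb false)) mE.
rewrite -measureU//.
  congr (P _); apply/seteqP; split => w /=.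
    by move=> [[Dw Ew] vw]; case Fw : (F t w); [left|right].
  by move=> [[[[Dw vw] _] Ew]|[[[Dw vw] _] Ew]].
by apply/seteqP; split => w //= [[[_ Fw] _] [[_ Fw'] _]]; move: Fw; rewrite Fw'.
Qed.

Let M (A : set cfg) := gibbs phi (cst lam%:E) (domain d L) A.

(** With nothing unresolved the kernel forgets its boundary condition, so the unknown functional
    enters only through the number [Phi (fun=> 1)], which the total mass [P D] eliminates. *)
Lemma gibbs_outside_final t (D : set Omega) (A : set cfg) : measurable A ->
  gibbs_outside t finset.set0 D -> P (D `&` X t @^-1` A) = P D * M A.
Proof.
move=> mA [hD DS [Phi sPhi HP]].
have n1 : nnmeasurable (fun _ : cfg => 1 : \bar R) by exact: nnmeasurable_cst.
have gE E : measurable E -> (fun zeta : cfg => gspec (~: (finset.set0 : {set vtx}))%SET zeta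
    (fun eta => (\1_E eta)%:E)) = fun=> K [set: vtx]%SET fset0 (fun xi => (\1_E xi)%:E).
  move=> mE; apply/funext => zeta; rewrite /gspec finset.setCK finset.setC0 rs0.
  by apply: gker_ext => [? _ //|xi xiD]; rewrite fset0U (rs_id xiD).
have cE E : measurable E ->
    P (D `&` X t @^-1` E) = K [set: vtx]%SET fset0 (fun xi => (\1_E xi)%:E) * Phi (fun=> 1).
  move=> mE; rewrite (HP _ mE) (gE _ mE).
  have f : K [set: vtx]%SET fset0 (fun xi => (\1_E xi)%:E) \is a fin_num.
    have := gspec_indic_fin r_gt0 lam_gt0 phi_rep (~: (finset.set0 : {set vtx}))%SET fset0 mE.
    by have /(congr1 (fun f => f fset0)) := gE _ mE => /= ->.
  have k0 := sfun_ge0 (sigma_functional_gker lam_gt0 phi_rep [set: vtx]%SET fset0)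
    (nnmeasurable_indic (R := R) mE).
  rewrite -(fineK f) -(sfunZ sPhi (fine_ge0 k0) n1).
  by congr Phi; apply/funext => zeta; rewrite mule1.
have Z1 : (fun xi : cfg => (\1_[set: cfg] xi)%:E) = fun=> 1 :> \bar R.
  by apply/funext => xi; rewrite indicE in_setT.
have PD : P D = K [set: vtx]%SET fset0 (fun=> 1) * Phi (fun=> 1).
  by have := cE _ measurableT; rewrite Z1 preimage_setT setIT.
have key (z a q : \bar R) : z \is a fin_num -> z != 0 -> a * q = z * q * (a / z).
  move=> zf z0; rewrite [RHS]muleC -muleA [z^-1 * _]muleA [z^-1 * z]muleC.
  by rewrite divee// mul1e.
rewrite PD (cE _ mA) /M (gibbs_domain_gker L lam phi r_gt0); apply: key.
  rewrite ge0_fin_numE; first exact: gker1_fin.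
  exact: le_trans (gker1_ge1 lam_gt0 phi_rep _ _).
by rewrite gt_eqF// (lt_le_trans _ (gker1_ge1 lam_gt0 phi_rep _ _)).
Qed.

(** Induction on the number [n] of remaining rounds, for all branches [D] at once: a round splits
    [D] by vertex and outcome, and every piece satisfies the invariant again. Once [S0] is empty the
    process is frozen and the invariant simply persists. *)
Lemma gibbs_outside_stop n t (S0 : {set vtx}) (D : set Omega) (A : set cfg) :
  measurable A -> gibbs_outside t S0 D ->
  P (D `&` ([set w | S (t + n) w = finset.set0] `&` X (t + n) @^-1` A)) =
  P (D `&` [set w | S (t + n) w = finset.set0]) * M A.
Proof.
move=> mA; elim: n t S0 D => [|n IH] t S0 D inv.
  rewrite addn0; have [hD DS _] := inv.
  have [S00|S00] := eqVneq S0 finset.set0.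
    rewrite S00 in inv DS; have /setIidPl e := DS.
    by rewrite setIA e; exact: gibbs_outside_final.
  have e : D `&` [set w | S t w = finset.set0] = set0.
    by apply/seteqP; split => w // [/DS /= ->] /eqP; rewrite (negbTE S00).
  by rewrite setIA e set0I measure0 mul0e.
have [hD DS [Phi sPhi HP]] := inv.
have [S00|S00] := eqVneq S0 finset.set0.
  rewrite addnS -addSn; apply: (IH _ finset.set0); split.
  - exact: historyS.
  - by move=> w /DS /= Sw; rewrite (process_stop proc _).1 ?Sw.
  - exists Phi; first exact: sPhi.
    move=> B mB; rewrite -S00 -(HP _ mB); congr (P _).
    apply/seteqP; split => w [Dw Bw]; split => //; move: Bw;
      by rewrite /= (process_stop proc _).2// (DS _ Dw).
have mE : measurable [set w | S (t + n.+1) w = finset.set0] by exact: process_measS proc _ _.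
have mEA : measurable ([set w | S (t + n.+1) w = finset.set0] `&` X (t + n.+1) @^-1` A).
  by apply: measurableI => //; exact: mpre (process_measX proc _) mA.
rewrite (round_split S00 hD DS mEA) (round_split S00 hD DS mE).
rewrite ge0_sume_distrl; last by move=> x _; exact: adde_ge0.
apply: eq_bigr => x xS; rewrite addnS -addSn ge0_muleDl//.
congr (_ + _).
  exact: (IH _ _ _ (gibbs_outside_accept xS hD DS sPhi HP)).
exact: (IH _ _ _ (gibbs_outside_reject xS hD DS sPhi HP)).
Qed.

Lemma gker_set0 (eta : {fset pt}) (g : cfg -> \bar R) : nnmeasurable g ->
  K (finset.set0 : {set vtx}) eta g = g fset0.
Proof.
move=> ng; rewrite (gker_itint lam_gt0 phi_rep)// nneseries_recl//; last first.
  move=> k _; rewrite mule_ge0 ?lee_fin ?invr_ge0//; apply: itint_ge0 => z.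
    exact: (nnmeasurable_activity lam_gt0 phi_rep _ _).2.
  by rewrite mule_ge0//; [exact: boltzmann_ge0|exact: ng.2].
rewrite eseries0 ?adde0; last first.
  move=> [//|k] _ _ /=; rewrite (eq_integral (fun=> 0)) ?integral0 ?mule0// => z _.
  suff -> : activity lam phi (finset.set0 : {set vtx}) eta z = 0 by rewrite mul0e.
  by apply/eqP; apply/negPn/negP => /activity_supp; rewrite region0.
rewrite /= fact0 invr1 mul1e /boltzmann/= oppr0 expR0 mul1e; congr g.
by apply/fsetP => x; rewrite in_seq_config inE.
Qed.

Lemma gibbs_outside_start : gibbs_outside 0 [set: vtx]%SET setT.
Proof.
split; first exact: (@measurableT _ (g_sigma_algebraType (history_event S v F Y X 0))).
  by move=> w _; exact: (process_S0 proc).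
(* The initial functional is evaluation at the empty configuration: the kernel acts on an empty
   region and only returns its boundary condition. *)
exists (fun f => f fset0).
  by split => // f nf; exact: nf.2.
move=> A mA; rewrite setTI /gspec finset.setCT gker_set0; last first.
  exact: (nnmeasurable_glue r_gt0 fset0 (finset.setI0 _) (nnmeasurable_indic mA)).
rewrite finset.setC0 (_ : (_ `|` _)%fset = fset0); last first.
  by apply/fsetP => x; rewrite !(inE, in_restr).
have [A0|A0] := pselect (A (fset0 : cfg)).
  rewrite (_ : _ @^-1` _ = setT); first by rewrite probability_setT indicE mem_set.
  by apply/seteqP; split => w // _; rewrite /= (process_X0 proc).
rewrite (_ : _ @^-1` _ = set0); first by rewrite measure0 indicE memNset.
by apply/seteqP; split => w //=; rewrite (process_X0 proc).
Qed.

End process.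

Theorem theorem5p2 (R : realType) (d : nat) (L r lam : R) (ell : nat)
  (phi : rpoint R d -> rpoint R d -> \bar R)
  (kappa : {set vertex d L r} -> vertex d L r -> {fset rpoint R d} -> R)
  (disp : measure_display) (Omega : measurableType disp)
  (P : probability Omega R)
  (S : nat -> Omega -> {set vertex d L r}) (v : nat -> Omega -> vertex d L r)
  (F : nat -> Omega -> bool) (Y X : nat -> Omega -> config R d) :
  (0 < d)%N -> 0 < L -> 0 < r -> 0 < lam -> (0 < ell)%N ->
  repulsive_potential r phi ->
  bayes_filter_correction phi lam ell kappa ->
  algorithm_process phi lam ell kappa P S v F Y X ->
  forall (t : nat) (A : set (config R d)),
    (0 < P [set w | S t w = finset.set0])%E ->
    measurable A -> A `<=` configs_in (domain d L) ->
    cond_prob P (X t @^-1` A) [set w | S t w = finset.set0] =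
      gibbs phi (cst lam%:E) (domain d L) A.
Proof.
move=> d0 _ r0 lam0 ell0 rep bfc proc t A PS mA _.
have start := gibbs_outside_start r0 lam0 rep proc.
have := gibbs_outside_stop d0 r0 lam0 ell0 rep bfc proc t mA start.
rewrite add0n !setTI /cond_prob setIC => ->.
rewrite muleAC divee ?mul1e//; last by rewrite gt_eqF.
by rewrite fin_num_measure//; exact: (process_measS proc).
Qed.
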